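(* Let $(\mathrm{Spec}(B),f)$ be a $1$-dimensional affine Landau-Ginzburg model over $S$ and let $(E,d,h)$ be an object of $\mathrm{Coh}^s(B,f)$, i.e. a bounded complex $(E_\bullet,d)$ of finitely generated projective $B$-modules, with components $d_i:E_i\to E_{i+1}$, together with maps $h_i:E_i\to E_{i-1}$ such that $h^2=0$ and $dh+hd=f$. Then in $\mathbf{Sing}(B,f)$ there is an equivalence between $(E,d,h)$ and the $K(B,f)$-dg module concentrated in degrees $-1$ and $0$ $$\underbrace{\bigoplus_{i\in\mathbb Z}E_{2i-1}}_{\text{degree }-1}\ \rightleftarrows\ \underbrace{\bigoplus_{i\in\mathbb Z}E_{2i}}_{\text{degree }0}$$ in which both the differential (from degree $-1$ to degree $0$) and the degree $-1$ operator (from degree $0$ to degree $-1$) are given by $d+h$. Moreover, this equivalence is natural in $(E,d,h)$.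
   Context: $A$ is a noetherian regular local ring of finite Krull dimension, $S=\mathrm{Spec}(A)$. A $1$-dimensional affine Landau-Ginzburg model over $S$ is a pair $(\mathrm{Spec}(B),f)$ with $B$ a flat $A$-algebra of finite type and $f\in B$ arbitrary (not assumed regular or flat). Dg categories are $A$-linear, considered up to Morita equivalence. For a derived scheme $Z$ of finite type over $S$ with cohomologically bounded structure sheaf, $\mathbf{Sing}(Z)=\mathbf{Coh}^b(Z)/\mathbf{Perf}(Z)$. With $X=\mathrm{Spec}(B)$, $X_0=X\times^h_{\mathbb A^1_S}S$ the derived zero locus of $f$ and $\mathfrak i:X_0\to X$, $\mathbf{Sing}(B,f)$ is the fiber of $\mathfrak i_*:\mathbf{Sing}(X_0)\to\mathbf{Sing}(X)$. $K(B,f)=B[\varepsilon]$ is the Koszul commutative dg algebra, $\varepsilon$ in degree $-1$, $\varepsilon^2=0$, $d\varepsilon=f$. A $K(B,f)$-dg module is a cochain complex of $B$-modules $(E,d)$ with a degree $-1$ map $h$ (the action of $\varepsilon$) such that $h^2=0$ and $dh+hd=f$. $\mathrm{Coh}^s(B,f)$ is the dg category of $K(B,f)$-dg modules whose underlying complex of $B$-modules is strictly perfect, and $\mathrm{Perf}^s(B,f)$ its full subcategory on modules perfect over $K(B,f)$. There is an equivalence $\mathrm{Coh}^s(B,f)/\mathrm{Perf}^s(B,f)\simeq\mathbf{Sing}(B,f)$, through which objects of $\mathrm{Coh}^s(B,f)$ are regarded as objects of $\mathbf{Sing}(B,f)$. Naturality means: a morphism $\phi:(E,d,h)\to(E',d',h')$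 of $K(B,f)$-dg modules corresponds to the morphism with components $\oplus\phi_{2i-1}$ and $\oplus\phi_{2i}$. *)

(* Defs.v *)
From HB Require Import structures.
From mathcomp Require Import all_boot all_order all_algebra.
From mathcomp Require Import boolp.
From mathcomp Require Import zify.

Set Implicit Arguments.
Unset Strict Implicit.
Unset Printing Implicit Defensive.

Import GRing.Theory.
Local Open Scope ring_scope.

(* Rings are [comPzRingType]s, so that the zero ring is an allowed value of
   the algebra B.  Ideals are arbitrary (Prop-valued) subsets. *)

Section Rings.
Variable A : comPzRingType.
Implicit Types I J m : A -> Prop.

Definition is_ideal I : Prop :=
  [/\ I 0, (forall x y, I x -> I y -> I (x + y)) & forall a x, I x -> I (a * x)].

Definition generates n (g : 'I_n -> A) I : Prop :=
  forall x, I x <-> exists c : 'I_n -> A, x = \sum_i c i * g i.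

Definition noetherian : Prop :=
  forall I, is_ideal I -> exists n (g : 'I_n -> A), generates g I.

Definition is_prime I : Prop :=
  [/\ is_ideal I, ~ I 1 & forall x y, I (x * y) -> I x \/ I y].

Definition is_maximal m : Prop :=
  [/\ is_ideal m, ~ m 1 &
    forall J, is_ideal J -> (forall x, m x -> J x) ->
      J 1 \/ (forall x, J x -> m x)].

Definition is_local_at m : Prop :=
  is_maximal m /\ forall m', is_maximal m' -> forall x, m' x <-> m x.

(* Only p 0, ..., p n matter: a strictly increasing chain of length n. *)
Definition prime_chain n (p : nat -> A -> Prop) : Prop :=
  (forall k, (k <= n)%N -> is_prime (p k)) /\
  (forall k, (k < n)%N ->
    (forall x, p k x -> p k.+1 x) /\ exists x, p k.+1 x /\ ~ p k x).

Definition krull_dim (d : nat) : Prop :=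
  (exists p, prime_chain d p) /\
  (forall n p, prime_chain n p -> (n <= d)%N).

(* The condition "regular": the maximal ideal m is generated by dim A elements. *)
Definition regular_local : Prop :=
  noetherian /\
  exists m d, [/\ is_local_at m, krull_dim d &
                  exists g : 'I_d -> A, generates g m].

End Rings.

Section Algebras.
Variables (A B : comPzRingType) (phi : {rmorphism A -> B}).

(* B is the only A-subalgebra of B containing the g i. *)
Definition finite_type : Prop :=
  exists n (g : 'I_n -> B), forall P : B -> Prop,
    (forall a, P (phi a)) -> (forall i, P (g i)) ->
    (forall x y, P x -> P y -> P (x + y)) ->
    (forall x y, P x -> P y -> P (x * y)) ->
    forall b, P b.

Definition A_bilinear (M T : lmodType A) (t : M -> B -> T) : Prop :=
  [/\ (forall x y b, t (x + y) b = t x b + t y b),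
      (forall x b c, t x (b + c) = t x b + t x c),
      (forall a x b, t (a *: x) b = a *: t x b)
    & (forall a x b, t x (phi a * b) = a *: t x b)].

(* [(T, t)] is a tensor product of M and B over A. *)
Definition is_tensor (M T : lmodType A) (t : M -> B -> T) : Prop :=
  A_bilinear t /\
  forall (P : lmodType A) (s : M -> B -> P), A_bilinear s ->
    exists2 u : {linear T -> P}, (forall x b, u (t x b) = s x b)
      & forall v : {linear T -> P}, (forall x b, v (t x b) = s x b) -> v =1 u.

Definition exact_at (X Y Z : zmodType) (u : X -> Y) (v : Y -> Z) : Prop :=
  forall y, v y = 0 <-> exists x, y = u x.

(* [v1], [v2] are the maps induced on tensor products, being determined by
   their values on pure tensors. *)
Definition flat : Prop :=
  forall (M1 M2 M3 : lmodType A) (u1 : {linear M1 -> M2}) (u2 : {linear M2 -> M3}),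
  exact_at u1 u2 ->
  forall (T1 T2 T3 : lmodType A)
    (t1 : M1 -> B -> T1) (t2 : M2 -> B -> T2) (t3 : M3 -> B -> T3),
  is_tensor t1 -> is_tensor t2 -> is_tensor t3 ->
  forall (v1 : {linear T1 -> T2}) (v2 : {linear T2 -> T3}),
  (forall x b, v1 (t1 x b) = t2 (u1 x) b) ->
  (forall x b, v2 (t2 x b) = t3 (u2 x) b) ->
  exact_at v1 v2.

End Algebras.

Section Modules.
Variable B : comPzRingType.

Definition finitely_generated (M : lmodType B) : Prop :=
  exists n (g : 'I_n -> M), forall x, exists c : 'I_n -> B, x = \sum_i c i *: g i.

Definition projective (P : lmodType B) : Prop :=
  forall (M N : lmodType B) (g : {linear M -> N}) (u : {linear P -> N}),
  (forall y, exists x, g x = y) ->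
  exists v : {linear P -> M}, forall x, g (v x) = u x.

End Modules.

Section Linear.
Variables (B : comPzRingType) (U V : lmodType B) (g : U -> V).
Hypothesis g_linear : linear g.
Let g' : U -> V := g.
HB.instance Definition _ := GRing.isLinear.Build B U V *:%R g' g_linear.
Definition mk_linear : {linear U -> V} := g'.
Lemma mk_linearE x : mk_linear x = g x. Proof. by []. Qed.
End Linear.

Section Transport.
Variables (B : comPzRingType) (F : int -> lmodType B).

(* The identity of [F i] when [i = j], and zero otherwise. *)
Definition transport i j : F i -> F j :=
  match i =P j with
  | ReflectT e => fun x => ecast k (F k) e x
  | ReflectF _ => fun=> 0
  end.

Lemma transport_linear i j : linear (@transport i j).
Proof.
rewrite /transport; case: eqP => [e|_] a x y; first by case: j / e.
by rewrite scaler0 addr0.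
Qed.

Lemma transport_id i (x : F i) : transport i x = x.
Proof.
rewrite /transport; case: eqP => // e.
by rewrite (eq_irrelevance e erefl).
Qed.

Lemma transport_neq i j (x : F i) : i != j -> transport j x = 0.
Proof. by rewrite /transport; case: eqP. Qed.

Lemma transport0 i j : @transport i j 0 = 0.
Proof. by have [<-|ij] := eqVneq i j; rewrite ?transport_id ?transport_neq. Qed.

Lemma transportD i j (x y : F i) :
  transport j (x + y) = transport j x + transport j y.
Proof. by have := @transport_linear i j 1 x y; rewrite !scale1r. Qed.

Lemma transportN i j (x : F i) : transport j (- x) = - transport j x.
Proof.
have [<-|ij] := eqVneq i j; first by rewrite !transport_id.
by rewrite !transport_neq // oppr0.
Qed.

End Transport.

Section DirectSum.
Variables (B : comPzRingType) (F : int -> lmodType B).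

Record dsum := DSum {
  dval :> forall i, F i;
  dval_fin : exists s : seq int, forall i, i \notin s -> dval i = 0 }.

Lemma dsumP (x y : dsum) : (forall i, x i = y i) -> x = y.
Proof.
case: x y => [x hx] [y hy] /= exy.
have e : x = y by exact: functional_extensionality_dep.
by case: y / e {exy} hy => hy; congr DSum; exact: Prop_irrelevance.
Qed.

HB.instance Definition _ := gen_eqMixin dsum.
HB.instance Definition _ := gen_choiceMixin dsum.

Fact dsum0_fin : exists s : seq int, forall i, i \notin s -> (0 : F i) = 0.
Proof. by exists [::]. Qed.
Definition dsum0 := DSum dsum0_fin.

Fact dsumD_fin (x y : dsum) :
  exists s : seq int, forall i, i \notin s -> x i + y i = 0.
Proof.
case: (dval_fin x) => s hs; case: (dval_fin y) => t ht; exists (s ++ t) => i.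
by rewrite mem_cat negb_or => /andP[/hs -> /ht ->]; rewrite addr0.
Qed.
Definition dsumD x y := DSum (dsumD_fin x y).

Fact dsumN_fin (x : dsum) : exists s : seq int, forall i, i \notin s -> - x i = 0.
Proof. by case: (dval_fin x) => s hs; exists s => i /hs ->; rewrite oppr0. Qed.
Definition dsumN x := DSum (dsumN_fin x).

Fact dsumZ_fin (a : B) (x : dsum) :
  exists s : seq int, forall i, i \notin s -> a *: x i = 0.
Proof. by case: (dval_fin x) => s hs; exists s => i /hs ->; rewrite scaler0. Qed.
Definition dsumZ a x := DSum (dsumZ_fin a x).

Fact dsum_addA : associative dsumD.
Proof. by move=> x y z; apply: dsumP => i; exact: addrA. Qed.
Fact dsum_addC : commutative dsumD.
Proof. by move=> x y; apply: dsumP => i; exact: addrC. Qed.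
Fact dsum_add0 : left_id dsum0 dsumD.
Proof. by move=> x; apply: dsumP => i; exact: add0r. Qed.
Fact dsum_addN : left_inverse dsum0 dsumN dsumD.
Proof. by move=> x; apply: dsumP => i; exact: addNr. Qed.

HB.instance Definition _ :=
  GRing.isZmodule.Build dsum dsum_addA dsum_addC dsum_add0 dsum_addN.

Fact dsum_scaleA a b (x : dsum) : dsumZ a (dsumZ b x) = dsumZ (a * b) x.
Proof. by apply: dsumP => i; exact: scalerA. Qed.
Fact dsum_scale1 : left_id 1 dsumZ.
Proof. by move=> x; apply: dsumP => i; exact: scale1r. Qed.
Fact dsum_scaleDr : right_distributive dsumZ +%R.
Proof. by move=> a x y; apply: dsumP => i; exact: scalerDr. Qed.
Fact dsum_scaleDl (x : dsum) : {morph dsumZ^~ x : a b / a + b}.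
Proof. by move=> a b; apply: dsumP => i; exact: scalerDl. Qed.

HB.instance Definition _ := GRing.Zmodule_isLmodule.Build B dsum
  dsum_scaleA dsum_scale1 dsum_scaleDr dsum_scaleDl.

Lemma dsumDE (x y : dsum) i : (x + y) i = x i + y i. Proof. by []. Qed.
Lemma dsumZE a (x : dsum) i : (a *: x) i = a *: x i. Proof. by []. Qed.

Lemma dsum_sumE (J : Type) (r : seq J) (G : J -> dsum) i :
  (\sum_(j <- r) G j) i = \sum_(j <- r) G j i.
Proof. by elim/big_rec2: _ => // j x y _ <-. Qed.

Fact dsum_inj_fin i (x : F i) :
  exists s : seq int, forall j, j \notin s -> transport j x = 0.
Proof.
by exists [:: i] => j; rewrite inE eq_sym => /(transport_neq x).
Qed.

Fact dsum_inj_linear i : linear (fun x : F i => DSum (dsum_inj_fin x)).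
Proof. by move=> a x y; apply: dsumP => j /=; exact: transport_linear. Qed.
Definition dsum_inj i : {linear F i -> dsum} := mk_linear (@dsum_inj_linear i).

Lemma dsum_decomp (s : seq int) (x : dsum) : uniq s ->
  (forall i, i \notin s -> x i = 0) -> x = \sum_(i <- s) dsum_inj i (x i).
Proof.
move=> us hs; apply: dsumP => j; rewrite dsum_sumE.
have [js|/[dup] jns /hs ->] := boolP (j \in s); last first.
  rewrite big_seq big1 // => i si; apply: transport_neq.
  by apply: contraNneq jns => <-.
rewrite (bigD1_seq j) //= [X in _ = X + _](transport_id (x j)).
rewrite big1 ?addr0 // => i ij.
by apply: transport_neq.
Qed.

Variable s : seq int.
Hypothesis us : uniq s.
Hypothesis F_bounded : forall i, i \notin s -> forall x : F i, x = 0.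

Lemma dsum_projective : (forall i, projective (F i)) -> projective dsum.
Proof.
move=> pF M N g u gs.
have lift i : exists v : {linear F i -> M}, forall x, g (v x) = u (dsum_inj i x).
  have L : linear (fun x => u (dsum_inj i x)) by move=> a x y; rewrite !linearP.
  exact: (pF i _ _ g (mk_linear L) gs).
pose v i := projT1 (cid (lift i)).
have hv i x : g (v i x) = u (dsum_inj i x) by exact: (projT2 (cid (lift i))).
have L : linear (fun x : dsum => \sum_(i <- s) v i (x i)).
  move=> a x y; rewrite scaler_sumr -big_split /=; apply: eq_bigr => i _.
  by rewrite linearP.
exists (mk_linear L) => x /=; rewrite linear_sum.
rewrite [in RHS](dsum_decomp (x := x) us); last by move=> i /F_bounded.
by rewrite linear_sum; apply: eq_bigr => i _.
Qed.

Lemma dsum_finitely_generated :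
  (forall i, finitely_generated (F i)) -> finitely_generated dsum.
Proof.
move=> fF.
have fg_seq (t : seq int) : exists n (g : 'I_n -> dsum), forall x : dsum,
    exists c : 'I_n -> B, \sum_(i <- t) dsum_inj i (x i) = \sum_k c k *: g k.
  elim: t => [|i t [n [g hg]]].
    by exists 0, (fun=> 0) => x; exists (fun=> 0); rewrite big_nil big_ord0.
  have [m [g' hg']] := fF i.
  exists (m + n)%N, (fun k => match split k with
    inl a => dsum_inj i (g' a) | inr b => g b end) => x.
  have [c' hc'] := hg' (x i); have [c hc] := hg x.
  exists (fun k => match split k with inl a => c' a | inr b => c b end).
  rewrite big_cons hc [x i]hc' linear_sum big_split_ord.
  congr (_ + _); apply: eq_bigr => k _.
    by rewrite linearZ (unsplitK (inl _ k)).
  by rewrite (unsplitK (inr _ k)).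
have [n [g hg]] := fg_seq s; exists n, g => x.
have [c hc] := hg x; exists c; rewrite -hc; apply: dsum_decomp => // i.
by move/F_bounded.
Qed.

End DirectSum.

Section Koszul.
Variables (B : comPzRingType) (f : B).

(* To avoid casts between degrees, d and h have a component between any two
   degrees, only those of degree 1, resp. -1, being possibly nonzero. *)
Record kdg := KDG {
  kmod :> int -> lmodType B;
  kd : forall i j, {linear kmod i -> kmod j};
  kh : forall i j, {linear kmod i -> kmod j};
  kd_deg : forall i j x, j != i + 1 -> kd i j x = 0;
  kh_deg : forall i j x, j != i - 1 -> kh i j x = 0;
  kdd : forall i j k x, kd j k (kd i j x) = 0;
  khh : forall i j k x, kh j k (kh i j x) = 0;
  kdh : forall i (x : kmod i),
    kd (i - 1) i (kh i (i - 1) x) + kh (i + 1) i (kd i (i + 1) x) = f *: x }.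

Lemma kdhE (E : kdg) i a b (x : E i) : a = i - 1 -> b = i + 1 ->
  kd E a i (kh E i a x) + kh E b i (kd E i b x) = f *: x.
Proof. by move=> -> ->; exact: kdh. Qed.

(* Closed K(B,f)-linear maps of degree 0. *)
Record kmor (E E' : kdg) := KMor {
  kmap :> forall i, {linear E i -> E' i};
  kmap_d : forall i j x, kmap j (kd E i j x) = kd E' i j (kmap i x);
  kmap_h : forall i j x, kmap j (kh E i j x) = kh E' i j (kmap i x) }.

Definition kid (E : kdg) : kmor E E.
Proof. by exists (fun i => idfun : {linear E i -> E i}). Defined.

Definition kcomp (E E' E'' : kdg) (v : kmor E' E'') (u : kmor E E') : kmor E E''.
Proof.
exists (fun i => v i \o u i : {linear E i -> E'' i}) => i j x /=.
- by rewrite !kmap_d.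
- by rewrite !kmap_h.
Defined.

(* The homotopy k is a K(B,f)-linear map of degree -1, whence the sign in its
   commutation with the action of the degree -1 element of K(B,f). *)
Definition homotopic (E E' : kdg) (u v : kmor E E') : Prop :=
  exists k : forall i j, {linear E i -> E' j},
  [/\ (forall i j x, j != i - 1 -> k i j x = 0),
      (forall i x, k (i - 1) (i - 1 - 1) (kh E i (i - 1) x)
                   = - kh E' (i - 1) (i - 1 - 1) (k i (i - 1) x))
    & (forall i x, u i x - v i x =
         kd E' (i - 1) i (k i (i - 1) x) + k (i + 1) i (kd E i (i + 1) x))].

(* u is bijective on cohomology. *)
Definition quasi_iso (E E' : kdg) (u : kmor E E') : Prop :=
  forall i,
  (forall x : E i, kd E i (i + 1) x = 0 ->
     (exists y, u i x = kd E' (i - 1) i y) -> exists z, x = kd E (i - 1) i z) /\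
  (forall y : E' i, kd E' i (i + 1) y = 0 ->
     exists x z, kd E i (i + 1) x = 0 /\ y = u i x + kd E' (i - 1) i z).

Section Cone.
Variables (E E' : kdg) (u : kmor E E').

Definition cone_mod (i : int) : lmodType B := (E (i + 1)%R * E' i)%type.

(* The degree i part of E[1] is E_{i+1}, with the opposite d and h; the
   transport is the identity of E'_{i+1} for j = i + 1, and 0 otherwise. *)
Definition cone_d_fun i j (x : cone_mod i) : cone_mod j :=
  (- kd E (i + 1) (j + 1) x.1,
   transport j (u (i + 1) x.1) + kd E' i j x.2).

Definition cone_h_fun i j (x : cone_mod i) : cone_mod j :=
  (- kh E (i + 1) (j + 1) x.1, kh E' i j x.2).

Fact cone_d_linear i j : linear (@cone_d_fun i j).
Proof.
move=> a x y; congr (_, _).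
  by rewrite /= linearP opprD scalerN.
by rewrite /= !linearP transport_linear addrACA scalerDr.
Qed.

Fact cone_h_linear i j : linear (@cone_h_fun i j).
Proof. by move=> a x y; congr (_, _); rewrite /= !linearP ?opprD ?scalerN. Qed.

Let cd i j : {linear cone_mod i -> cone_mod j} := mk_linear (@cone_d_linear i j).
Let ch i j : {linear cone_mod i -> cone_mod j} := mk_linear (@cone_h_linear i j).

Fact cone_d_deg i j x : j != i + 1 -> cd i j x = 0.
Proof.
case: x => x y ij; rewrite mk_linearE /cone_d_fun /= !kd_deg //; last first.
  by apply: contraNneq ij => /addIr ->.
by rewrite transport_neq 1?eq_sym // oppr0 addr0.
Qed.

Fact cone_h_deg i j x : j != i - 1 -> ch i j x = 0.
Proof.
case: x => x y ij; rewrite mk_linearE /cone_h_fun /= !kh_deg ?oppr0 //.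
by apply: contraNneq ij => ?; apply/eqP; lia.
Qed.

Fact cone_dd i j k x : cd j k (cd i j x) = 0.
Proof.
case: x => x y; rewrite !mk_linearE /cone_d_fun /=; congr (_, _).
  by rewrite linearN /= kdd !oppr0.
rewrite linearD /= kdd addr0 linearN transportN kmap_d.
have [<-|ji] := eqVneq (i + 1) j; last first.
  rewrite (transport_neq _ ji) linear0 addr0 kd_deg ?transport0 ?oppr0 //.
  by apply: contraNneq ji => /addIr ->.
rewrite transport_id.
have [<-|kj] := eqVneq (i + 1 + 1) k; first by rewrite transport_id addNr.
by rewrite transport_neq // oppr0 add0r kd_deg // eq_sym.
Qed.

Fact cone_hh i j k x : ch j k (ch i j x) = 0.
Proof.
case: x => x y; rewrite !mk_linearE /cone_h_fun /=; congr (_, _).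
  by rewrite linearN /= khh !oppr0.
by rewrite khh.
Qed.

Fact cone_dh i (x : cone_mod i) :
  cd (i - 1) i (ch i (i - 1) x) + ch (i + 1) i (cd i (i + 1) x) = f *: x.
Proof.
case: x => x y; rewrite !mk_linearE /cone_d_fun /cone_h_fun /=; congr (_, _) => /=.
  by rewrite !linearN !opprK kdhE //; lia.
rewrite [X in X + _](_ : _ = - u i (kh E (i + 1) i x)
                             + kd E' (i - 1) i (kh E' i (i - 1) y)); last first.
  by rewrite subrK transport_id linearN.
rewrite transport_id linearD /= kmap_h addrACA addNr add0r.
exact: kdh.
Qed.

Definition cone : kdg := KDG cone_d_deg cone_h_deg cone_dd cone_hh cone_dh.

End Cone.

Section TwoTerm.
Variables (M N : lmodType B) (p : {linear M -> N}) (q : {linear N -> M}).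
Hypotheses (pq : forall y, p (q y) = f *: y) (qp : forall x, q (p x) = f *: x).

(* [Negz 0] is the integer -1. *)
Definition two_term_mod (i : int) : lmodType B :=
  match i with Posz 0 => N | Negz 0 => M | _ => 'rV[B]_0 end.

Definition two_term_d_fun i j : two_term_mod i -> two_term_mod j :=
  match i return two_term_mod i -> two_term_mod j with
  | Negz 0 => match j return M -> two_term_mod j with
              | Posz 0 => p | _ => fun=> 0 end
  | _ => fun=> 0
  end.

Definition two_term_h_fun i j : two_term_mod i -> two_term_mod j :=
  match i return two_term_mod i -> two_term_mod j with
  | Posz 0 => match j return N -> two_term_mod j with
              | Negz 0 => q | _ => fun=> 0 end
  | _ => fun=> 0
  end.

Fact two_term_d_linear i j : linear (@two_term_d_fun i j).
Proof.
case: i => [[|i]|[|i]] a x y; rewrite /= ?scaler0 ?addr0 //.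
by case: j => [[|j]|[|j]]; rewrite /= ?linearP ?scaler0 ?addr0.
Qed.

Fact two_term_h_linear i j : linear (@two_term_h_fun i j).
Proof.
case: i => [[|i]|[|i]] a x y; rewrite /= ?scaler0 ?addr0 //.
by case: j => [[|j]|[|j]]; rewrite /= ?linearP ?scaler0 ?addr0.
Qed.

Let td i j := mk_linear (@two_term_d_linear i j).
Let th i j := mk_linear (@two_term_h_linear i j).

Fact two_term_d_deg i j x : j != i + 1 -> td i j x = 0.
Proof. by case: i x => [[|i]|[|i]] //; case: j => [[|j]|[|j]]. Qed.

Fact two_term_h_deg i j x : j != i - 1 -> th i j x = 0.
Proof. by case: i x => [[|i]|[|i]] //; case: j => [[|j]|[|j]]. Qed.

Fact two_term_dd i j k x : td j k (td i j x) = 0.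
Proof.
case: i x => [[|i]|[|i]] x; rewrite ?linear0 //.
by case: j => [[|j]|[|j]]; rewrite ?linear0.
Qed.

Fact two_term_hh i j k x : th j k (th i j x) = 0.
Proof.
case: i x => [[|i]|[|i]] x; rewrite ?linear0 //.
by case: j => [[|j]|[|j]]; rewrite ?linear0.
Qed.

Fact two_term_dh i (x : two_term_mod i) :
  td (i - 1) i (th i (i - 1) x) + th (i + 1) i (td i (i + 1) x) = f *: x.
Proof.
case: i x => [[|i]|[|i]] x; try by rewrite [LHS]thinmx0 [RHS]thinmx0.
- by rewrite [X in _ + X]linear0 addr0; exact: pq.
- by rewrite [X in td _ _ X](_ : _ = 0) // linear0 add0r; exact: qp.
Qed.

Definition two_term : kdg :=
  KDG two_term_d_deg two_term_h_deg two_term_dd two_term_hh two_term_dh.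

End TwoTerm.

Section TwoTermMap.
Variables (M N M' N' : lmodType B).
Variables (p : {linear M -> N}) (q : {linear N -> M}).
Variables (p' : {linear M' -> N'}) (q' : {linear N' -> M'}).
Hypotheses (pq : forall y, p (q y) = f *: y) (qp : forall x, q (p x) = f *: x).
Hypotheses (pq' : forall y, p' (q' y) = f *: y) (qp' : forall x, q' (p' x) = f *: x).
Variables (v : {linear M -> M'}) (w : {linear N -> N'}).
Hypotheses (wp : forall x, w (p x) = p' (v x)) (vq : forall y, v (q y) = q' (w y)).

Definition two_term_map_fun i : two_term_mod M N i -> two_term_mod M' N' i :=
  match i with Posz 0 => w | Negz 0 => v | _ => idfun end.

Fact two_term_map_linear i : linear (@two_term_map_fun i).
Proof. by case: i => [[|i]|[|i]] a x y; rewrite /= ?linearP. Qed.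

Let tm i := mk_linear (@two_term_map_linear i).

Fact two_term_map_d i j x :
  tm j (kd (two_term pq qp) i j x) = kd (two_term pq' qp') i j (tm i x).
Proof.
case: i x => [[|i]|[|i]] x; rewrite ?linear0 //.
by case: j => [[|j]|[|j]]; rewrite ?linear0 //; exact: wp.
Qed.

Fact two_term_map_h i j x :
  tm j (kh (two_term pq qp) i j x) = kh (two_term pq' qp') i j (tm i x).
Proof.
case: i x => [[|i]|[|i]] x; rewrite ?linear0 //.
by case: j => [[|j]|[|j]]; rewrite ?linear0 //; exact: vq.
Qed.

Definition two_term_map : kmor (two_term pq qp) (two_term pq' qp') :=
  @KMor (two_term pq qp) (two_term pq' qp') tm two_term_map_d two_term_map_h.

End TwoTermMap.

Fact mulf_linear : linear (fun x : B^o => f *: x).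
Proof. by move=> a x y; rewrite scalerDr !scalerA mulrC. Qed.

(* K(B,f) as a module over itself: the generator of degree -1 is 1 in the copy
   of B in degree -1. *)
Definition koszul : kdg :=
  @two_term B^o B^o (mk_linear mulf_linear) idfun (fun=> erefl) (fun=> erefl).

(* The thick subcategory of the derived category of K(B,f) generated by
   K(B,f). *)
Inductive perfect : kdg -> Prop :=
| perf_koszul : perfect koszul
| perf_qis E E' (u : kmor E E') : quasi_iso u -> perfect E -> perfect E'
| perf_qis_inv E E' (u : kmor E E') : quasi_iso u -> perfect E' -> perfect E
| perf_cone E E' (u : kmor E E') : perfect E -> perfect E' -> perfect (cone u)
| perf_source E E' (u : kmor E E') : perfect E' -> perfect (cone u) -> perfect E
| perf_target E E' (u : kmor E E') : perfect E -> perfect (cone u) -> perfect E'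
| perf_retract E E' (s : kmor E E') (r : kmor E' E) :
    homotopic (kcomp r s) (kid E) -> perfect E' -> perfect E.

Definition strictly_perfect (E : kdg) : Prop :=
  (exists n : nat, forall i : int, (n < `|i|)%N -> forall x : E i, x = 0) /\
  (forall i, finitely_generated (E i) /\ projective (E i)).

Record cohs := CohS { coh_kdg :> kdg; coh_sperf : strictly_perfect coh_kdg }.

(* The homotopy category of the dg quotient Coh^s(B,f)/Perf^s(B,f): the
   localization of the category of closed degree 0 maps up to homotopy at the
   maps whose cone lies in Perf^s(B,f); the cone being strictly perfect, this
   means that it is perfect over K(B,f).  The localization is the Verdier
   quotient, Coh^s(B,f) being stable under shifts and cones.  Morphisms are the elements of
   [sing_hom], freely generated by maps and formal inverses, taken up to the
   congruence [sing_eq]. *)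
Inductive sing_hom : cohs -> cohs -> Type :=
| sing_map (E E' : cohs) : kmor E E' -> sing_hom E E'
| sing_inv (E E' : cohs) (s : kmor E E') : perfect (cone s) -> sing_hom E' E
| sing_comp E E' E'' : sing_hom E' E'' -> sing_hom E E' -> sing_hom E E''.

Definition sing_id (E : cohs) : sing_hom E E := sing_map (kid E).

Inductive sing_eq : forall E E' : cohs, sing_hom E E' -> sing_hom E E' -> Prop :=
| sing_refl E E' (a : sing_hom E E') : sing_eq a a
| sing_sym E E' (a b : sing_hom E E') : sing_eq a b -> sing_eq b a
| sing_trans E E' (a b c : sing_hom E E') :
    sing_eq a b -> sing_eq b c -> sing_eq a c
| sing_congr E E' E'' (a a' : sing_hom E' E'') (b b' : sing_hom E E') :
    sing_eq a a' -> sing_eq b b' -> sing_eq (sing_comp a b) (sing_comp a' b')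
| sing_assoc E1 E2 E3 E4 (a : sing_hom E3 E4) (b : sing_hom E2 E3)
    (c : sing_hom E1 E2) :
    sing_eq (sing_comp a (sing_comp b c)) (sing_comp (sing_comp a b) c)
| sing_idl E E' (a : sing_hom E E') : sing_eq (sing_comp (sing_id E') a) a
| sing_idr E E' (a : sing_hom E E') : sing_eq (sing_comp a (sing_id E)) a
| sing_map_comp (E E' E'' : cohs) (v : kmor E' E'') (u : kmor E E') :
    sing_eq (sing_comp (sing_map v) (sing_map u))
            (sing_map (E := E) (E' := E'') (kcomp v u))
| sing_homotopic (E E' : cohs) (u v : kmor E E') :
    homotopic u v -> sing_eq (sing_map u) (sing_map v)
| sing_invl (E E' : cohs) (s : kmor E E') (ps : perfect (cone s)) :
    sing_eq (sing_comp (sing_inv ps) (sing_map s)) (sing_id E)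
| sing_invr (E E' : cohs) (s : kmor E E') (ps : perfect (cone s)) :
    sing_eq (sing_comp (sing_map s) (sing_inv ps)) (sing_id E').

(* Equivalences in the dg category Sing(B,f) are the isomorphisms of its
   homotopy category. *)
Definition sing_equivalence (E E' : cohs) (a : sing_hom E E') : Prop :=
  exists b : sing_hom E' E,
    sing_eq (sing_comp b a) (sing_id E) /\ sing_eq (sing_comp a b) (sing_id E').

Section Fold.
Variable E : kdg.

Definition odd_part := dsum (fun j => E (2 * j - 1)).
Definition even_part := dsum (fun j => E (2 * j)).

(* The components of d + h with value in E_{2j}, resp. in E_{2j-1}. *)
Definition odd_to_even_val (x : odd_part) j : E (2 * j) :=
  kd E (2 * j - 1) (2 * j) (x j) + kh E (2 * (j + 1) - 1) (2 * j) (x (j + 1)).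

Definition even_to_odd_val (y : even_part) j : E (2 * j - 1) :=
  kd E (2 * (j - 1)) (2 * j - 1) (y (j - 1)) + kh E (2 * j) (2 * j - 1) (y j).

Fact odd_to_even_fin x :
  exists s : seq int, forall j, j \notin s -> odd_to_even_val x j = 0.
Proof.
case: (dval_fin x) => s hs; exists (s ++ [seq j - 1 | j <- s]) => j.
rewrite mem_cat negb_or => /andP[/hs xj js].
rewrite /odd_to_even_val xj linear0 add0r hs ?linear0 //.
by apply: contra js => js; apply/mapP; exists (j + 1); rewrite ?addrK.
Qed.

Fact even_to_odd_fin y :
  exists s : seq int, forall j, j \notin s -> even_to_odd_val y j = 0.
Proof.
case: (dval_fin y) => s hs; exists (s ++ [seq j + 1 | j <- s]) => j.
rewrite mem_cat negb_or => /andP[/hs yj js].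
rewrite /even_to_odd_val yj linear0 addr0 hs ?linear0 //.
by apply: contra js => js; apply/mapP; exists (j - 1); rewrite ?subrK.
Qed.

Fact odd_to_even_linear : linear (fun x => DSum (odd_to_even_fin x) : even_part).
Proof.
move=> a x y; apply: dsumP => j /=; rewrite /odd_to_even_val !dsumDE !dsumZE.
by rewrite !linearP /= addrACA scalerDr.
Qed.

Fact even_to_odd_linear : linear (fun y => DSum (even_to_odd_fin y) : odd_part).
Proof.
move=> a x y; apply: dsumP => j /=; rewrite /even_to_odd_val !dsumDE !dsumZE.
by rewrite !linearP /= addrACA scalerDr.
Qed.

Definition odd_to_even : {linear odd_part -> even_part} :=
  mk_linear odd_to_even_linear.
Definition even_to_odd : {linear even_part -> odd_part} :=
  mk_linear even_to_odd_linear.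

Fact odd_even_odd x : even_to_odd (odd_to_even x) = f *: x.
Proof.
apply: dsumP => j; rewrite !mk_linearE dsumZE /= /even_to_odd_val /=.
rewrite /odd_to_even_val !linearD /= kdd khh add0r addr0 subrK.
by apply: kdhE; lia.
Qed.

Fact even_odd_even y : odd_to_even (even_to_odd y) = f *: y.
Proof.
apply: dsumP => j; rewrite !mk_linearE dsumZE /= /odd_to_even_val /=.
rewrite /even_to_odd_val !linearD /= kdd khh add0r addr0 addrK.
by apply: kdhE; lia.
Qed.

Definition fold_kdg : kdg := two_term even_odd_even odd_even_odd.

End Fold.

Section FoldMap.
Variables (E E' : kdg) (u : kmor E E').

Fact odd_map_fin (x : odd_part E) :
  exists s : seq int, forall j, j \notin s -> u (2 * j - 1) (x j) = 0.
Proof. by case: (dval_fin x) => s hs; exists s => j /hs ->; rewrite linear0. Qed.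

Fact even_map_fin (y : even_part E) :
  exists s : seq int, forall j, j \notin s -> u (2 * j) (y j) = 0.
Proof. by case: (dval_fin y) => s hs; exists s => j /hs ->; rewrite linear0. Qed.

Fact odd_map_linear : linear (fun x => DSum (odd_map_fin x) : odd_part E').
Proof. by move=> a x y; apply: dsumP => j /=; rewrite linearP. Qed.

Fact even_map_linear : linear (fun y => DSum (even_map_fin y) : even_part E').
Proof. by move=> a x y; apply: dsumP => j /=; rewrite linearP. Qed.

Definition odd_map := mk_linear odd_map_linear.
Definition even_map := mk_linear even_map_linear.

Fact fold_map_d x : even_map (odd_to_even E x) = odd_to_even E' (odd_map x).
Proof.
by apply: dsumP => j; rewrite /= /odd_to_even_val linearD /= !kmap_d !kmap_h.
Qed.

Fact fold_map_h y : odd_map (even_to_odd E y) = even_to_odd E' (even_map y).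
Proof.
by apply: dsumP => j; rewrite /= /even_to_odd_val linearD /= !kmap_d !kmap_h.
Qed.

Definition fold_map : kmor (fold_kdg E) (fold_kdg E') :=
  two_term_map _ _ _ _ fold_map_d fold_map_h.

End FoldMap.

Definition int_range (n : nat) : seq int :=
  [seq k%:Z - n%:Z | k <- iota 0 (2 * n).+1].

Lemma int_range_uniq n : uniq (int_range n).
Proof.
by rewrite map_inj_uniq ?iota_uniq // => k l /addIr [].
Qed.

Lemma int_range_notin n (i : int) : i \notin int_range n -> (n < `|i|)%N.
Proof.
apply: contraNT => hi; apply/mapP; exists (absz (i + n%:Z)); last by lia.
by rewrite mem_iota; lia.
Qed.

Lemma fold_strictly_perfect E : strictly_perfect E -> strictly_perfect (fold_kdg E).
Proof.
move=> [[n hn] hE].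
have dsum_fgp (e : int -> int) : (forall j : int, (n < `|j|)%N -> (n < `|e j|)%N) ->
    finitely_generated (dsum (fun j => E (e j))) /\
    projective (dsum (fun j => E (e j))).
  move=> he; have bnd j : j \notin int_range n -> forall x : E (e j), x = 0.
    by move=> /int_range_notin /he /hn.
  have us := int_range_uniq n.
  split; [apply: dsum_finitely_generated us bnd _ |
          apply: dsum_projective us bnd _] => j; by case: (hE (e j)).
split.
  exists 1 => -[[|[|i]]|[|i]] // _ x; exact: thinmx0.
have zero_fgp : finitely_generated 'rV[B]_0 /\ projective 'rV[B]_0.
  split; first by exists 0, (fun=> 0) => x; exists (fun=> 0); rewrite [LHS]thinmx0 big_ord0.
  move=> M N g u _.
  have L : linear (fun _ : 'rV[B]_0 => 0 : M) by move=> a x y; rewrite /= scaler0 addr0.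
  by exists (mk_linear L) => x; rewrite [x]thinmx0 !linear0.
case=> [[|i]|[|i]] //=; apply: dsum_fgp => j; lia.
Qed.

Definition fold (E : cohs) : cohs := CohS (fold_strictly_perfect (coh_sperf E)).

End Koszul.

(* Main.v *)
(* For a walk r : Z -> Z with steps of length one, the graded module whose
   degree n part is the sum of the E_k with r k = n is again a dg module, since
   d + h changes r by one in either direction.  The identity walk gives E, and a
   walk with values in {-1, 0} gives the fold of E.  Let S be a set of local
   maxima of r at a single value b, and let r' be r lowered by 2 on S.  The two
   regradings embed in a common cylinder, by maps iota and psi, where psi is a
   quasi-isomorphism and the cone of iota is quasi-isomorphic to a shift of
   K(B,f) (x) E_S, hence perfect; so they are naturally isomorphic in Sing(B,f).
   Clamping the identity walk to shrinking windows [-1-m, m] connects E to its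
   fold, and the result does not depend on the first window, as long as it
   contains the support of E: this gives the naturality. *)
Require Import Defs.
From HB Require Import structures.
From mathcomp Require Import all_boot all_order all_algebra.
From mathcomp Require Import boolp.
From mathcomp Require Import zify.

Set Implicit Arguments.
Unset Strict Implicit.
Unset Printing Implicit Defensive.

Import Order.TTheory GRing.Theory.
Local Open Scope ring_scope.

(** A map of dg modules from E to its fold preserves degrees, so it sees only E_{-1} and E_0.
    Degrees k and k - 2 can be identified only once perfect modules are killed, hence through
    zigzags. Moving a single set S at a time keeps each zigzag explicit: no two elements of S are
    adjacent, so d + h has no component inside E_S, and all neighbours of S sit at b - 1, where they
    are compatible with S at b as well as at b - 2. The cylinder carries E_S in the degrees b, b - 1
    and b - 2. Modulo the image of psi the copies in degrees b - 1 and b remain, joined by the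
    identity, so they cancel. Modulo the image of iota the copies in degrees b - 2 and b - 1 remain,
    with d = -f and h = -1 between them: a free K(B,f)-module on the bare module E_S. *)

Lemma addr0_eqN (V : zmodType) (x y : V) : x + y = 0 -> x = - y.
Proof. by move=> /eqP; rewrite addr_eq0 => /eqP. Qed.

Lemma oppr0_eq (V : zmodType) (x : V) : - x = 0 -> x = 0.
Proof. by move=> /eqP; rewrite oppr_eq0 => /eqP. Qed.

(** * Acyclic modules, cones of quasi-isomorphisms and extensions of perfect modules *)

Section QuasiIso.
Variables (B : comPzRingType) (f : B).
Implicit Types E F : kdg f.

Definition acyclic E : Prop :=
  forall i (x : E i), kd E i (i + 1) x = 0 -> exists z, x = kd E (i - 1) i z.

Lemma kd_pred E i j (x : E i) : kd E i (i + 1) x = 0 -> kd E i j x = 0.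
Proof.
by have [->|/kd_deg ->] := eqVneq j (i + 1).
Qed.

Lemma bij_quasi_iso E F (u : kmor E F) :
  (forall i, exists v : F i -> E i, cancel (u i) v /\ cancel v (u i)) ->
  quasi_iso u.
Proof.
move=> hu i; have [v [uK vK]] := hu i; split=> [x dx [y exy]|y dy].
  have [w [_ wK]] := hu (i - 1); exists (w y).
  by apply: (can_inj uK); rewrite kmap_d wK.
exists (v y), 0; rewrite linear0 addr0 vK; split=> //.
by have [w [wK _]] := hu (i + 1); apply: (can_inj wK); rewrite kmap_d vK dy linear0.
Qed.

Lemma cone_dE E F (u : kmor E F) i (x : E (i + 1)) (y : F i) :
  kd (cone u) i (i + 1) (x, y) =
  (- kd E (i + 1) (i + 1 + 1) x, u (i + 1) x + kd F i (i + 1) y).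
Proof. by rewrite /= /cone_d_fun /= transport_id. Qed.

Lemma cone_dE' E F (u : kmor E F) i (x : E (i - 1 + 1)) (y : F (i - 1)) :
  kd (cone u) (i - 1) i (x, y) =
  (- kd E (i - 1 + 1) (i + 1) x,
   transport i (u (i - 1 + 1) x) + kd F (i - 1) i y).
Proof. by []. Qed.

(** The injectivity half of [quasi_iso] with the lower degree as a variable, so that cones, which
    produce degrees [i + 1], never meet [i + 1 - 1]. *)
Lemma quasi_iso_inj E F (u : kmor E F) i j (x : E j) (y : F i) :
  quasi_iso u -> j = i + 1 -> (forall k, kd E j k x = 0) ->
  u j x = kd F i j y -> exists z, x = kd E i j z.
Proof.
move=> qu ej dx uxy; have [h _] := qu j; have ei : j - 1 = i by rewrite ej addrK.
by case: _ / ei y uxy => y uxy; apply: h => //; exists y.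
Qed.

Lemma quasi_iso_acyclic E F (u : kmor E F) : quasi_iso u -> acyclic (cone u).
Proof.
move=> qu i [x y]; rewrite cone_dE => -[/oppr0_eq dx uxy].
have [|z xz] := quasi_iso_inj qu erefl (fun k => kd_pred k dx) (y := - y).
  by rewrite linearN; exact: addr0_eqN.
have [_ hsurj] := qu i.
have [|w [v [dw yw]]] := hsurj (y + u i z).
  by rewrite linearD /= -kmap_d -xz [LHS]addrC.
(* The primitive is (w - z, v). Its first entry lies in [E i], whereas the cone in degree i - 1 asks
   for [E (i - 1 + 1)]. *)
have ei' : i = i - 1 + 1 by lia.
have hz : exists zz : E (i - 1 + 1),
    - kd E (i - 1 + 1) (i + 1) zz = x /\ transport i (u (i - 1 + 1) zz) = - u i z + u i w.
  case: _ / ei'; exists (w - z); rewrite transport_id linearB /= dw add0r opprK -xz.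
  by split=> //; rewrite linearB [LHS]addrC.
have [zz [h1 h2]] := hz.
exists (zz, v); rewrite cone_dE'; congr (_, _) => //.
by rewrite h2 -addrA -yw [RHS]addrC addrK.
Qed.

Definition zero_kdg : kdg f.
Proof.
pose z (i j : int) : {linear 'rV[B]_0 -> 'rV[B]_0} := idfun.
by exists (fun=> 'rV[B]_0) z z => *; rewrite [LHS]thinmx0 [RHS]thinmx0.
Defined.

Definition to_zero E : kmor E zero_kdg.
Proof.
have L i : linear (fun _ : E i => 0 : 'rV[B]_0) by move=> a x y; rewrite scaler0 addr0.
by exists (fun i => mk_linear (L i) : {linear E i -> zero_kdg i}) => i j x;
  rewrite [LHS]thinmx0 [RHS]thinmx0.
Defined.

Lemma acyclic_to_zero E : acyclic E -> quasi_iso (to_zero E).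
Proof.
move=> hE i; split=> [x dx _|y _]; first exact: hE.
by exists 0, 0; rewrite linear0; split=> //; rewrite [LHS]thinmx0 [RHS]thinmx0.
Qed.

Lemma id_quasi_iso E : quasi_iso (kid E).
Proof. by apply: bij_quasi_iso => i; exists id. Qed.

(** [perfect] starts from [koszul] alone, so zero is reached as the cone of the identity of
    [koszul], up to quasi-isomorphism. *)
Lemma perfect_zero : perfect zero_kdg.
Proof.
apply: perf_qis (acyclic_to_zero (quasi_iso_acyclic (id_quasi_iso (koszul f)))) _.
by apply: perf_cone; exact: perf_koszul.
Qed.

Lemma perfect_acyclic E : acyclic E -> perfect E.
Proof. by move=> /acyclic_to_zero h; exact: perf_qis_inv h perfect_zero. Qed.

Lemma perfect_cone_qis E F (u : kmor E F) : quasi_iso u -> perfect (cone u).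
Proof. by move=> /quasi_iso_acyclic; exact: perfect_acyclic. Qed.

Section ShortExact.
Variables (X Y Q : kdg f) (u : kmor X Y) (v : kmor Y Q).
Hypothesis u_inj : forall i, injective (u i).
Hypothesis v_surj : forall i z, exists y, v i y = z.
Hypothesis uv : forall i y, v i y = 0 <-> exists x, y = u i x.

Fact cone_quot_linear i : linear (fun x : cone u i => v i x.2).
Proof. by move=> a x y /=; rewrite linearP. Qed.

Definition cone_quot : kmor (cone u) Q.
Proof.
exists (fun i => mk_linear (@cone_quot_linear i)) => i j [x y] /=.
  rewrite linearD /= kmap_d [X in X + _](_ : _ = 0) ?add0r //.
  have [<-|ij] := eqVneq (i + 1) j; last by rewrite transport_neq ?linear0.
  by rewrite transport_id; apply/uv; exists x.
by rewrite kmap_h.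
Defined.

(** If v y = d z, lift z to y'; then y - d y' = u x' and the cocycle (x, y) is the boundary of (x',
    y'). Conversely a cocycle z lifts to some y with d y = u x, and (-x, y) is a cocycle above z. *)
Lemma cone_quot_qis : quasi_iso cone_quot.
Proof.
move=> i; split=> [[x y]|z dz].
  rewrite cone_dE => -[/oppr0_eq dx uxy] [z /= vyz].
  have [y' vy'] := v_surj z.
  have [x' yx'] : exists x', y - kd Y (i - 1) i y' = u i x'.
    by apply/uv; rewrite linearB /= vyz kmap_d vy' subrr.
  have ex : x = - kd X i (i + 1) x'.
    apply: u_inj; rewrite linearN /= kmap_d -yx' linearB /= kdd subr0.
    exact: addr0_eqN.
  have ei' : i = i - 1 + 1 by lia.
  have [xx [h1 h2]] : exists xx : X (i - 1 + 1),
    - kd X (i - 1 + 1) (i + 1) xx = x /\ transport i (u (i - 1 + 1) xx) = u i x'.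
    by case: _ / ei'; exists x'; rewrite transport_id ex.
  by exists (xx, y'); rewrite [RHS]cone_dE' h1 h2 -yx' subrK.
have [y vy] := v_surj z.
have [x yx] : exists x, kd Y i (i + 1) y = u (i + 1) x.
  by apply/uv; rewrite kmap_d vy.
exists ((- x, y) : cone u i), 0; rewrite linear0 addr0; split; last by [].
rewrite cone_dE !linearN /= opprK yx addNr; congr (_, _).
by apply: u_inj; rewrite kmap_d -yx kdd linear0.
Qed.

Lemma perfect_extension : perfect X -> perfect Q -> perfect Y.
Proof. by move=> pX pQ; apply: perf_target pX (perf_qis_inv cone_quot_qis pQ). Qed.

End ShortExact.
End QuasiIso.

(** * Shifts preserve perfection *)

Section Shift.
Variables (B : comPzRingType) (f : B).
Implicit Types E F : kdg f.

Definition shift (n : int) E : kdg f.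
Proof.
exists (fun i => E (i + n)) (fun i j => kd E (i + n) (j + n))
  (fun i j => kh E (i + n) (j + n)) => [i j x ij|i j x ij|i j k x|i j k x|i x].
- by apply: kd_deg; apply: contraNneq ij => ?; apply/eqP; lia.
- by apply: kh_deg; apply: contraNneq ij => ?; apply/eqP; lia.
- exact: kdd.
- exact: khh.
- by apply: kdhE; lia.
Defined.

(* The cone of E -> 0 is E[1], whose d and h carry a sign, unlike those of the
   shift: hence the sign. *)
Fact shift1_linear E i :
  linear (fun x : shift 1 E i => ((-1) ^+ odd `|i| *: x, 0) : cone (to_zero E) i).
Proof.
move=> a x y; congr (_, _); last by rewrite [RHS]thinmx0.
by rewrite scalerDr scalerA mulrC -scalerA.
Qed.

Lemma odd_absS (i j : int) : j = i + 1 \/ j = i - 1 -> odd `|j| = ~~ odd `|i|.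
Proof. by move=> []; lia. Qed.

Definition shift1 E : kmor (shift 1 E) (cone (to_zero E)).
Proof.
exists (fun i => mk_linear (@shift1_linear E i)) => i j x /=; congr (_, _).
- rewrite linearZ /= -scaleNr; have [ij|ij] := eqVneq j (i + 1).
    by rewrite (@odd_absS i j) ?ij; last left => //; case: odd; rewrite ?opprK.
  by rewrite [kd _ _ _ _]kd_deg ?scaler0 //; apply: contraNneq ij => ?; apply/eqP; lia.
- by rewrite [RHS]thinmx0.
- rewrite linearZ /= -scaleNr; have [ij|ij] := eqVneq j (i - 1).
    by rewrite (@odd_absS i j) ?ij; last right => //; case: odd; rewrite ?opprK.
  by rewrite [kh _ _ _ _]kh_deg ?scaler0 //; apply: contraNneq ij => ?; apply/eqP; lia.
Defined.

Lemma shift1_qis E : quasi_iso (shift1 E).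
Proof.
apply: bij_quasi_iso => i; exists (fun y => (-1) ^+ odd `|i| *: y.1).
split=> [x|[x y]] /=; first by rewrite scalerA -signr_addb addbb scale1r.
by congr (_, _); rewrite ?scalerA -?signr_addb ?addbb ?scale1r // [RHS]thinmx0.
Qed.

Lemma perfect_shift1 E : perfect (shift 1 E) <-> perfect E.
Proof.
split=> pE; last first.
  by apply: perf_qis_inv (@shift1_qis E) _; apply: perf_cone => //; exact: perfect_zero.
by apply: perf_source (@perfect_zero _ f) _; apply: perf_qis (@shift1_qis E) pE.
Qed.

(** The hypothesis makes a = c equivalent to b = d: either both transports are identities, or both
    sides vanish. *)
Lemma transport_kd E a b c d (x : E a) : a - c = b - d ->
  transport d (kd E a b x) = kd E c d (transport c x).
Proof.
move=> e; have [ac|ac] := eqVneq a c.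
  have bd : b = d by lia.
  by case: _ / ac e => e; case: _ / bd e => e; rewrite !transport_id.
by rewrite !transport_neq ?linear0 //; apply: contraNneq ac => ?; apply/eqP; lia.
Qed.

Lemma transport_kh E a b c d (x : E a) : a - c = b - d ->
  transport d (kh E a b x) = kh E c d (transport c x).
Proof.
move=> e; have [ac|ac] := eqVneq a c.
  have bd : b = d by lia.
  by case: _ / ac e => e; case: _ / bd e => e; rewrite !transport_id.
by rewrite !transport_neq ?linear0 //; apply: contraNneq ac => ?; apply/eqP; lia.
Qed.

Definition shift_shift E m n k : kmor (shift m (shift n E)) (shift k E).
Proof.
exists (fun i => mk_linear (@transport_linear _ E (i + m + n) (i + k))) => i j x /=.
- by apply: transport_kd; lia.
- by apply: transport_kh; lia.
Defined.

Lemma transportK (F : int -> lmodType B) i j :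
  i = j -> cancel (@transport B F i j) (@transport B F j i).
Proof. by move=> <- x; rewrite !transport_id. Qed.

Lemma shift_shift_qis E m n k : k = m + n -> quasi_iso (shift_shift E m n k).
Proof.
move=> e; apply: bij_quasi_iso => i; exists (@transport B E (i + k) (i + m + n)).
by split; apply: (@transportK E); lia.
Qed.

Definition unshift0 E : kmor (shift 0 E) E.
Proof.
exists (fun i => mk_linear (@transport_linear _ E (i + 0) i)) => i j x /=.
- by apply: transport_kd; lia.
- by apply: transport_kh; lia.
Defined.

Lemma perfect_shift0 E : perfect (shift 0 E) <-> perfect E.
Proof.
have q : quasi_iso (unshift0 E).
  apply: bij_quasi_iso => i; exists (@transport B E i (i + 0)).
  by split; apply: (@transportK E); lia.
by split; [exact: perf_qis | exact: perf_qis_inv].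
Qed.

Lemma perfect_shift n E : perfect (shift n E) <-> perfect E.
Proof.
have S m : perfect (shift (m + 1) E) <-> perfect (shift m E).
  have q := @shift_shift_qis E 1 m (m + 1) (addrC _ _).
  rewrite -[X in _ <-> X]perfect_shift1.
  by split; [exact: perf_qis_inv | exact: perf_qis].
rewrite -[X in _ <-> X]perfect_shift0.
elim: n => [|n IHn|n IHn] //; rewrite -IHn. have -> : n.+1%:Z = n%:Z + 1 by lia. exact: S.
by have := S (- n.+1%:Z); rewrite (_ : - n.+1%:Z + 1 = - n%:Z); [tauto | lia].
Qed.

End Shift.

(** * Free K(B,f)-modules on finitely generated projective B-modules *)

Section Free.
Variables (B : comPzRingType) (f : B).

Section FreeModule.
Variable X : lmodType B.

Fact scale_linear : linear (fun x : X => f *: x).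
Proof. by move=> a x y; rewrite scalerDr !scalerA mulrC. Qed.

(* K(B,f) (x)_B X, with X in degree 0. *)
Definition free : kdg f :=
  @two_term B f X X (mk_linear scale_linear) idfun (fun=> erefl) (fun=> erefl).

Section Induced.
Variables (F : kdg f) (g : {linear X -> F 0}).
Hypothesis dg : forall x, kd F 0 1 (g x) = 0.

(** The universal property of the free module: g picks cocycles in degree 0, and linearity over
    K(B,f) forces h o g in degree -1. *)
Definition free_map_fun i : free i -> F i :=
  match i with Posz 0 => g | Negz 0 => fun x => kh F 0 (Negz 0) (g x) | _ => fun=> 0 end.

Fact free_map_linear i : linear (@free_map_fun i).
Proof. by case: i => [[|i]|[|i]] a x y; rewrite /= ?linearP ?scaler0 ?addr0. Qed.

Definition free_map : kmor free F.
Proof.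
exists (fun i => mk_linear (@free_map_linear i)).
  case=> [[|i]|[|i]] j x; rewrite ?linear0 //=.
  - rewrite ?linear0; have [->|j1] := eqVneq j 1; first by rewrite dg.
    by rewrite kd_deg.
  - case: j => [[|j]|[|j]] /=; try by rewrite [RHS]kd_deg // ?linear0.
    have := kdh (g x); rewrite dg linear0 addr0 => ->.
    by rewrite linearZ.
case=> [[|i]|[|i]] j x; rewrite ?linear0 //=.
- by case: j => [[|j]|[|j]] //=; rewrite [RHS]kh_deg // ?linear0.
- by rewrite ?linear0 khh.
Defined.

End Induced.
End FreeModule.

Section FreeMap.
Variables (X Y : lmodType B) (g : {linear X -> Y}).

Fact free_funct_d x : g (f *: x) = f *: g x. Proof. exact: linearZ. Qed.

Definition free_funct : kmor (free X) (free Y) :=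
  @two_term_map B f X X Y Y (mk_linear (scale_linear (X:=X))) idfun
   (mk_linear (scale_linear (X:=Y))) idfun (fun=> erefl) (fun=> erefl)
   (fun=> erefl) (fun=> erefl) g g free_funct_d (fun=> erefl).

End FreeMap.

(** An iterated product instead of row vectors, so that inductions split off one factor of B at a
    time. *)
Fixpoint pow n : lmodType B := if n is m.+1 then (B^o * pow m)%type else 'rV[B]_0.

(** [koszul] and [free B^o] differ only in the proof that multiplication by f is linear, so the
    identity compares them. *)
Lemma perfect_free_base : perfect (free B^o).
Proof.
pose u : kmor (koszul f) (free B^o) :=
  @two_term_map B f B^o B^o B^o B^o (mk_linear (mulf_linear f)) idfun
    (mk_linear (scale_linear (X:=B^o))) idfun (fun=> erefl) (fun=> erefl)
    (fun=> erefl) (fun=> erefl) idfun idfun (fun=> erefl) (fun=> erefl).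
have q : quasi_iso u.
  apply: bij_quasi_iso => i.
  case: i => [[|i]|[|i]]; exists (fun x => x); split => x //.
exact: perf_qis q (perf_koszul f).
Qed.

Lemma perfect_free_pow n : perfect (free (pow n)).
Proof.
elim: n => [|n IHn].
  apply: perfect_acyclic => i x _; exists 0; rewrite linear0.
  by case: i x => [[|i]|[|i]] x; exact: thinmx0.
have Li : linear (fun b : B^o => (b, 0) : pow n.+1).
  by move=> a x y; congr (_, _); rewrite /= scaler0 addr0.
have Lp : linear (fun x : pow n.+1 => x.2) by [].
apply: (@perfect_extension _ _ (free B^o) _ (free (pow n))
  (free_funct (mk_linear Li)) (free_funct (mk_linear Lp))) IHn.
- by case=> [[|i]|[|i]] //= x y [].
- case=> [[|i]|[|i]] //= z; first [by exists z | by exists (0, z)].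
- case=> [[|i]|[|i]] y /=; split=> [|[x ->]] //.
  + by case: y => b y /= ->; exists b.
  + by exists y.
  + exact: thinmx0.
  + by case: y => b y /= ->; exists b.
  + by exists y.
  + exact: thinmx0.
- exact: perfect_free_base.
Qed.

Lemma fg_pow_surj (X : lmodType B) : finitely_generated X ->
  exists n (g : {linear pow n -> X}), forall x, exists y, g y = x.
Proof.
move=> [n [g hg]].
suff [h hh] : exists h : {linear pow n -> X}, forall c : 'I_n -> B,
    exists y, h y = \sum_i c i *: g i.
  by exists n, h => x; have [c ->] := hg x; exact: hh.
elim: n g {hg} => [|n IHn] g.
  have L : linear (fun _ : pow 0 => 0 : X) by move=> a x y; rewrite scaler0 addr0.
  by exists (mk_linear L) => c; exists 0; rewrite big_ord0.
have [h hh] := IHn (g \o lift ord0).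
have L : linear (fun x : pow n.+1 => x.1 *: g ord0 + h x.2).
  by move=> a x y; rewrite /= linearP scalerDl -scalerA scalerDr addrACA.
exists (mk_linear L) => c; have [y hy] := hh (c \o lift ord0).
by exists (c ord0, y); rewrite mk_linearE /= hy big_ord_recl.
Qed.

Lemma perfect_free (X : lmodType B) :
  finitely_generated X -> projective X -> perfect (free X).
Proof.
move=> /fg_pow_surj[n [g gs]] /(_ _ _ g idfun gs) [s gK].
apply: (@perf_retract _ _ (free X) (free (pow n)) (free_funct s) (free_funct g));
  last exact: perfect_free_pow.
(* The retraction of modules holds strictly, so the homotopy is zero. *)
exists (fun i j => \0 : {linear free X i -> free X j}).
split=> [//|i x|i x] /=; first by
  apply/esym/eqP; rewrite oppr_eq0; apply/eqP; exact: (linear0 (kh (free X) _ _)).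
rewrite addr0; transitivity (0 : free X i); last first.
  by apply/esym; exact: (linear0 (kd (free X) (i - 1) i)).
apply/eqP; rewrite subr_eq0; apply/eqP.
by case: i x => [[|i]|[|i]] x //=; exact: gK.
Qed.

End Free.

(** * Summands of the total sum of a graded module *)

Section Retract.
Variables (B : comPzRingType) (X Y : lmodType B).
Variables (s : {linear X -> Y}) (p : {linear Y -> X}).
Hypothesis sK : cancel s p.

Lemma fg_retract : finitely_generated Y -> finitely_generated X.
Proof.
move=> [n [g hg]]; exists n, (p \o g) => x; have [c e] := hg (s x); exists c.
by rewrite -[x]sK e linear_sum; apply: eq_bigr => i _; rewrite linearZ.
Qed.

Lemma projective_retract : projective Y -> projective X.
Proof.
move=> pY M N g u gs; have [v hv] := pY M N g (u \o p : {linear Y -> N}) gs.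
by exists (v \o s : {linear X -> M}) => x /=; rewrite hv /= sK.
Qed.
End Retract.

Section Parts.
Variables (B : comPzRingType) (F : int -> lmodType B).

Fact pr_fin (Q : pred int) (x : dsum F) :
  exists s : seq int, forall k, k \notin s -> (if Q k then x k else 0) = 0.
Proof. by case: (dval_fin x) => s hs; exists s => k /hs ->; case: ifP. Qed.

Fact pr_linear Q : linear (fun x : dsum F => DSum (pr_fin Q x)).
Proof. by move=> a x y; apply: dsumP => k /=; case: ifP => // _; rewrite scaler0 addr0. Qed.

Definition pr Q : {linear dsum F -> dsum F} := mk_linear (pr_linear Q).

Lemma prE Q x k : pr Q x k = if Q k then x k else 0. Proof. by []. Qed.

Definition supported (Q : pred int) : {pred dsum F} := fun x => pr Q x == x.

Lemma dsumNE (x : dsum F) k : (- x) k = - x k. Proof. by []. Qed.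

Lemma supportedP (Q : pred int) (x : dsum F) :
  reflect (forall k, ~~ Q k -> x k = 0) (x \in supported Q).
Proof.
apply: (iffP eqP) => [<- k|h]; first by rewrite prE => /negbTE ->.
by apply: dsumP => k; rewrite prE; case: ifPn => // /h.
Qed.

Fact supported_submod Q : submod_closed (supported Q).
Proof.
split=> [|a x y]; rewrite /supported !unfold_in; first by rewrite linear0.
by move=> /eqP hx /eqP hy; rewrite linearP hx hy.
Qed.

HB.instance Definition _ Q :=
  GRing.isSubmodClosed.Build B (dsum F) (supported Q) (supported_submod Q).

(** A graded piece is kept as a submodule of the whole sum, indexed by the original degrees: d + h
    is then a single operator, and changing the grading requires no cast. *)
Record part Q := Part { pval : dsum F; _ : pval \in supported Q }.

HB.instance Definition _ Q := [isSub for @pval Q].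
HB.instance Definition _ Q := [Choice of part Q by <:].
HB.instance Definition _ Q := [SubChoice_isSubLmodule of part Q by <:].

Lemma pval_linear Q : linear (@pval Q). Proof. by []. Qed.
Definition incl Q : {linear part Q -> dsum F} := mk_linear (@pval_linear Q).

Lemma incl0 Q (x : part Q) k : ~~ Q k -> incl Q x k = 0.
Proof. by case: x => x hx; apply/supportedP. Qed.

Lemma incl_zero Q k : incl Q 0 k = 0.
Proof. by rewrite linear0. Qed.

Lemma partP Q (x y : part Q) :
  (forall k, Q k -> incl Q x k = incl Q y k) -> x = y.
Proof.
move=> h; apply: val_inj; apply: dsumP => k.
by case: (boolP (Q k)) => [/h//|nQ]; rewrite [LHS](incl0 x nQ) [RHS](incl0 y nQ).
Qed.

Fact cut_supported (b : bool) Q (x : dsum F) : pr (fun k => b && Q k) x \in supported Q.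
Proof. by apply/supportedP => k /negbTE h; rewrite prE h andbF. Qed.

Fact cut_linear b Q : linear (fun x => Part (cut_supported b Q x)).
Proof. by move=> a x y; apply: val_inj; exact: (linearP (pr (fun k => b && Q k))). Qed.

(** The boolean switches the truncation off, which gives the zero components of d and h between
    unrelated degrees uniformly. *)
Definition cut b Q : {linear dsum F -> part Q} := mk_linear (@cut_linear b Q).

Lemma cutE b Q x k : incl Q (cut b Q x) k = if b && Q k then x k else 0.
Proof. by []. Qed.

Lemma inclK Q : cancel (incl Q) (cut true Q).
Proof. by move=> x; apply: partP => k Qk; rewrite cutE /= Qk. Qed.

End Parts.

Arguments pr {B F} Q.
Arguments incl {B F} Q.
Arguments incl_zero {B F} Q k.
Arguments cut {B F} b Q.

(** * The operator d + h and its square *)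

Definition nb (k m : int) : bool := (m == k + 1) || (m == k - 1).

Section Total.
Variables (B : comPzRingType) (f : B) (E : kdg f).

Definition tot_val (x : dsum E) k : E k :=
  kd E (k - 1) k (x (k - 1)) + kh E (k + 1) k (x (k + 1)).

Fact tot_fin x : exists s : seq int, forall k, k \notin s -> tot_val x k = 0.
Proof.
case: (dval_fin x) => s hs; exists ([seq k + 1 | k <- s] ++ [seq k - 1 | k <- s]) => k.
rewrite mem_cat negb_or => /andP[ks1 ks2]; rewrite /tot_val !hs ?linear0 ?addr0 //.
- by apply: contra ks2 => h; apply/mapP; exists (k + 1); rewrite ?addrK.
- by apply: contra ks1 => h; apply/mapP; exists (k - 1); rewrite ?subrK.
Qed.

Fact tot_linear : linear (fun x => DSum (tot_fin x)).
Proof.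
move=> a x y; apply: dsumP => k /=; rewrite /tot_val.
by rewrite !dsumDE !dsumZE !linearP /= addrACA scalerDr.
Qed.

Definition tot : {linear dsum E -> dsum E} := mk_linear tot_linear.

Lemma tot_eq0 (x : dsum E) k : x (k - 1) = 0 -> x (k + 1) = 0 -> tot x k = 0.
Proof. by move=> h1 h2; rewrite /= /tot_val h1 h2 !linear0 addr0. Qed.

(** In (d + h)^2 the paths that change the degree by 2 are d^2 and h^2, which vanish. Only the two
    paths from k to a neighbour and back survive, and P decides which of them are kept. *)
Lemma tot_pr_tot (P : pred int) (x : dsum E) k :
  tot (pr P (tot x)) k =
  (if P (k - 1) then kd E (k - 1) k (kh E k (k - 1) (x k)) else 0) +
  (if P (k + 1) then kh E (k + 1) k (kd E k (k + 1) (x k)) else 0).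
Proof.
rewrite /= /tot_val /= /tot_val.
congr (_ + _); case: ifP => _; rewrite ?linear0 // linearD /= ?kdd ?khh.
  by rewrite add0r subrK.
by rewrite addr0 addrK.
Qed.

Lemma tot_nb_eq0 (x : dsum E) k : (forall m, nb k m -> x m = 0) -> tot x k = 0.
Proof. by move=> h; apply: tot_eq0; apply: h; rewrite /nb eqxx ?orbT. Qed.

Lemma tot_nb_eq (x y : dsum E) k :
  (forall m, nb k m -> x m = y m) -> tot x k = tot y k.
Proof.
by move=> h; rewrite /= /tot_val !h // /nb eqxx ?orbT.
Qed.

(** Each of the two round trips from k is allowed by exactly one of P and Q, so the sum is dh +
    hd. *)
Lemma tot_pr_tot2 (P Q : pred int) (x : dsum E) k :
  (forall m, nb k m -> P m (+) Q m) ->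
  tot (pr P (tot x)) k + tot (pr Q (tot x)) k = f *: x k.
Proof.
move=> h; rewrite !tot_pr_tot addrACA.
have := h (k - 1); have := h (k + 1); rewrite /nb !eqxx orbT => /(_ isT) h1 /(_ isT) h2.
rewrite -(@kdhE _ _ _ _ _ _ (x k) erefl erefl); congr (_ + _).
  by case: (P _) (Q _) h2 => [] []; rewrite ?addr0 ?add0r.
by case: (P _) (Q _) h1 => [] []; rewrite ?addr0 ?add0r.
Qed.

Lemma tot_pr_tot_in (P : pred int) (x : dsum E) k :
  (forall m, nb k m -> P m) -> tot (pr P (tot x)) k = f *: x k.
Proof.
move=> h; rewrite -(@tot_pr_tot2 P pred0) => [|m /h -> //].
by rewrite [X in _ + X]tot_pr_tot !addr0.
Qed.

Lemma tot_pr_tot0 (P : pred int) (x : dsum E) k : x k = 0 -> tot (pr P (tot x)) k = 0.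
Proof. by rewrite tot_pr_tot => ->; rewrite !linear0 !if_same addr0. Qed.

End Total.

(** * Regrading a dg module along a walk *)

Record walk := Walk {
  wval :> int -> int;
  walkP : forall k, wval (k + 1) = wval k + 1 \/ wval (k + 1) = wval k - 1 }.

Lemma walkP' (r : walk) k : r (k - 1) = r k + 1 \/ r (k - 1) = r k - 1.
Proof. by have := walkP r (k - 1); rewrite subrK; lia. Qed.

Lemma walk_nb (r : walk) k m : nb k m -> r m = r k + 1 \/ r m = r k - 1.
Proof. by move=> /orP[] /eqP ->; [exact: walkP | exact: walkP']. Qed.

Section Regrade.
Variables (B : comPzRingType) (f : B) (E : kdg f) (r : walk).

Definition reg_mod (i : int) : lmodType B := part E (fun k => r k == i).

Definition reg_d i j : {linear reg_mod i -> reg_mod j} :=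
  cut (j == i + 1) _ \o tot E \o incl _.

Definition reg_h i j : {linear reg_mod i -> reg_mod j} :=
  cut (j == i - 1) _ \o tot E \o incl _.

Lemma reg_dE i j x k :
  incl _ (reg_d i j x) k = if (j == i + 1) && (r k == j) then tot E (incl _ x) k else 0.
Proof. by []. Qed.

Lemma reg_hE i j x k :
  incl _ (reg_h i j x) k = if (j == i - 1) && (r k == j) then tot E (incl _ x) k else 0.
Proof. by []. Qed.

Lemma incl_reg_d i j x : j = i + 1 ->
  incl _ (reg_d i j x) = pr (fun k => r k == j) (tot E (incl _ x)).
Proof. by move=> ->; apply: dsumP => k; rewrite reg_dE prE eqxx. Qed.

Lemma incl_reg_h i j x : j = i - 1 ->
  incl _ (reg_h i j x) = pr (fun k => r k == j) (tot E (incl _ x)).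
Proof. by move=> ->; apply: dsumP => k; rewrite reg_hE prE eqxx. Qed.

Fact reg_d_deg i j x : j != i + 1 -> reg_d i j x = 0.
Proof. by move=> /negbTE ij; apply: partP => k _; rewrite reg_dE ij linear0. Qed.

Fact reg_h_deg i j x : j != i - 1 -> reg_h i j x = 0.
Proof. by move=> /negbTE ij; apply: partP => k _; rewrite reg_hE ij linear0. Qed.

(** Two steps up raise r by 2, whereas a surviving path of length two returns to its starting point,
    where r is unchanged. *)
Fact reg_dd i j l x : reg_d j l (reg_d i j x) = 0.
Proof.
have [->|jl] := eqVneq l (j + 1); last by rewrite reg_d_deg.
have [->|ij] := eqVneq j (i + 1); last by rewrite [X in reg_d _ _ X]reg_d_deg ?linear0.
apply: partP => k /eqP rk; rewrite reg_dE incl_reg_d // linear0; case: ifP => // _.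
by apply: tot_pr_tot0; apply: incl0; lia.
Qed.

Fact reg_hh i j l x : reg_h j l (reg_h i j x) = 0.
Proof.
have [->|jl] := eqVneq l (j - 1); last by rewrite reg_h_deg.
have [->|ij] := eqVneq j (i - 1); last by rewrite [X in reg_h _ _ X]reg_h_deg ?linear0.
apply: partP => k /eqP rk; rewrite reg_hE incl_reg_h // linear0; case: ifP => // _.
by apply: tot_pr_tot0; apply: incl0; lia.
Qed.

Fact reg_dh i x :
  reg_d (i - 1) i (reg_h i (i - 1) x) + reg_h (i + 1) i (reg_d i (i + 1) x) = f *: x.
Proof.
apply: partP => k /eqP rk.
rewrite linearD linearZ dsumDE dsumZE reg_dE reg_hE incl_reg_d // incl_reg_h //.
have -> : (i == i - 1 + 1) && (r k == i) by lia.
have -> : (i == i + 1 - 1) && (r k == i) by lia.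
rewrite -dsumDE -linearD.
(* x lives where r = i, so d + h carries it to places where r = i - 1 or r = i + 1: the two
   projections together lose nothing. *)
have -> : pr (fun k => r k == i - 1) (tot E (incl _ x)) +
          pr (fun k => r k == i + 1) (tot E (incl _ x)) = pr predT (tot E (incl _ x)).
  apply: dsumP => m; rewrite dsumDE !prE /=.
  have [e|n1] := boolP (r m == i - 1); first by rewrite ifN ?addr0 //; lia.
  rewrite add0r; case: ifPn => // n2; apply/esym/tot_nb_eq0 => l /(walk_nb r) ml.
  by apply: incl0; lia.
exact: tot_pr_tot_in.
Qed.

Definition reg : kdg f := KDG reg_d_deg reg_h_deg reg_dd reg_hh reg_dh.

Lemma fgp_part Q : strictly_perfect E -> finitely_generated (part E Q) /\ projective (part E Q).
Proof.
move=> [[n hn] hE].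
have bnd j : j \notin int_range n -> forall x : E j, x = 0 by move=> /int_range_notin /hn.
have us := int_range_uniq n.
split.
  apply: fg_retract (@inclK _ _ Q) _; apply: dsum_finitely_generated us bnd _ => j.
  by case: (hE j).
apply: projective_retract (@inclK _ _ Q) _; apply: dsum_projective us bnd _ => j.
by case: (hE j).
Qed.

Lemma strictly_perfect_bound : strictly_perfect E ->
  exists s : seq int, forall k, k \notin s -> forall x : E k, x = 0.
Proof. by move=> [[n hn] _]; exists (int_range n) => k /int_range_notin /hn. Qed.

Lemma bounded_abs (g : int -> int) (s : seq int) :
  exists n : nat, forall k, k \in s -> (`|g k| <= n)%N.
Proof.
elim: s => [|k s [n hn]]; first by exists 0.
exists (maxn `|g k| n) => j; rewrite inE => /orP[/eqP ->|/hn]; lia.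
Qed.

Lemma reg_strictly_perfect : strictly_perfect E -> strictly_perfect reg.
Proof.
move=> pE; split; last by move=> i; exact: fgp_part.
have [s hs] := strictly_perfect_bound pE; have [n hn] := bounded_abs r s.
exists n => i ni x; apply: partP => k /eqP rk; rewrite linear0.
by apply: hs; apply: contraL ni => /hn; rewrite rk -leqNgt.
Qed.

End Regrade.

Definition creg (B : comPzRingType) (f : B) (r : walk) (E : cohs f) : cohs f :=
  CohS (reg_strictly_perfect r (coh_sperf E)).

(** * Functoriality of the regrading *)

Section DsumMap.
Variables (B : comPzRingType) (f : B) (E E' : kdg f) (u : kmor E E').

Fact dsum_map_fin (x : dsum E) : exists s : seq int, forall k, k \notin s -> u k (x k) = 0.
Proof. by case: (dval_fin x) => s hs; exists s => k /hs ->; rewrite linear0. Qed.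

Fact dsum_map_linear : linear (fun x => DSum (dsum_map_fin x)).
Proof. by move=> a x y; apply: dsumP => k /=; rewrite linearP. Qed.

Definition dsum_map : {linear dsum E -> dsum E'} := mk_linear dsum_map_linear.

Lemma dsum_map_tot x k : dsum_map (tot E x) k = tot E' (dsum_map x) k.
Proof. by rewrite /= /tot_val linearD /= kmap_d kmap_h. Qed.

Lemma dsum_map_totE x : dsum_map (tot E x) = tot E' (dsum_map x).
Proof. by apply: dsumP => k; exact: dsum_map_tot. Qed.

Lemma dsum_map_pr Q x : dsum_map (pr Q x) = pr Q (dsum_map x).
Proof. by apply: dsumP => k /=; case: ifP => // _; rewrite linear0. Qed.

Definition part_map Q : {linear part E Q -> part E' Q} :=
  cut true _ \o dsum_map \o incl _.

Lemma incl_part_map Q (x : part E Q) : incl _ (part_map Q x) = dsum_map (incl _ x).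
Proof.
apply: dsumP => k; rewrite cutE /=; case: ifPn => // /(incl0 x) /= ->.
by rewrite linear0.
Qed.

Lemma part_map_cut b Q x : part_map Q (cut b Q x) = cut b Q (dsum_map x).
Proof.
apply: partP => k Qk; rewrite incl_part_map !cutE /= Qk.
by case: ifP => // _; rewrite linear0.
Qed.

Definition reg_map (r : walk) : kmor (reg E r) (reg E' r).
Proof.
exists (fun i => part_map _ : {linear reg E r i -> reg E' r i}) => i j x.
- by rewrite [LHS]part_map_cut dsum_map_totE -incl_part_map.
- by rewrite [LHS]part_map_cut dsum_map_totE -incl_part_map.
Defined.

End DsumMap.

(** * Products of finitely generated projective modules *)

Section Product.
Variables (B : comPzRingType) (X Y : lmodType B).

Lemma fg_prod : finitely_generated X -> finitely_generated Y ->
  finitely_generated (X * Y)%type.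
Proof.
move=> [m [g hg]] [n [g' hg']].
exists (m + n)%N, (fun k => match split k with
  inl a => (g a, 0) | inr b => (0, g' b) end) => -[x y].
have [c ->] := hg x; have [c' ->] := hg' y.
exists (fun k => match split k with inl a => c a | inr b => c' b end).
rewrite big_split_ord /=.
have splitl k : split (lshift n k) = inl k :> 'I_m + 'I_n by exact: (unsplitK (inl k)).
have splitr k : split (rshift m k) = inr k :> 'I_m + 'I_n by exact: (unsplitK (inr k)).
under [X in _ = X + _]eq_bigr => k _ do rewrite splitl.
under [X in _ = _ + X]eq_bigr => k _ do rewrite splitr.
have E1 (I : finType) (F : I -> X * Y) : \sum_i F i = (\sum_i (F i).1, \sum_i (F i).2).
  by elim/big_rec3: _ => // i x1 x2 x3 _ ->.
rewrite !E1; congr (_, _) => /=.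
  by rewrite [X in _ + X]big1 ?addr0 // => i _; rewrite scaler0.
by rewrite [X in X + _]big1 ?add0r // => i _; rewrite scaler0.
Qed.

Lemma projective_prod : projective X -> projective Y -> projective (X * Y)%type.
Proof.
move=> pX pY M N g u gs.
have L1 : linear (fun x : X => (x, 0) : X * Y) by
  move=> a x y; congr (_, _); rewrite /= scaler0 addr0.
have L2 : linear (fun y : Y => (0, y) : X * Y) by
  move=> a x y; congr (_, _); rewrite /= scaler0 addr0.
have [v1 h1] := pX M N g (u \o mk_linear L1 : {linear X -> N}) gs.
have [v2 h2] := pY M N g (u \o mk_linear L2 : {linear Y -> N}) gs.
have L : linear (fun x : X * Y => v1 x.1 + v2 x.2).
  by move=> a x y; rewrite /= !linearP addrACA scalerDr.
exists (mk_linear L) => -[x y]; rewrite mk_linearE linearD h1 h2 /= -linearD.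
by congr (u (_, _)); rewrite ?addr0 ?add0r.
Qed.
End Product.

(** * The cylinder between the regradings by r and by r' *)

Section Flip.
Variables (B : comPzRingType) (f : B) (r r' : walk) (S : pred int) (b : int).
Hypothesis r_top : forall k, S k -> r k = b.
Hypothesis r_max : forall k m, S k -> nb k m -> r m = b - 1.
Hypothesis r'E : forall k, r' k = if S k then r k - 2 else r k.

(** Since r is constantly b on S, this is S for n = b and empty otherwise. *)
Definition top (n : int) : pred int := fun k => S k && (r k == n).
Definition rest (n : int) : pred int := fun k => ~~ S k && (r k == n).
(* [new n] is the set of the k with r' k = n, and [any n] that of the k with
   r k = n or r' k = n. *)
Definition new (n : int) : pred int := fun k => (~~ S k && (r k == n)) || (S k && (r k == n + 2)).
Definition any (n : int) : pred int := fun k => (r k == n) || (S k && (r k == n + 2)).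

Lemma newE n k : (r' k == n) = new n k.
Proof. by rewrite r'E /new; case: (S k) => /=; lia. Qed.

Section Cylinder.
Variable E : kdg f.

(* S sits in the degrees prescribed by r and by r' at once; d maps the first
   factor identically to the copy of S in degree i + 1, which cancels both. *)
Definition cyl_mod (i : int) : lmodType B := (part E (top (i + 1)) * part E (any i))%type.

(** Because of [rest], the copy of S in degree b receives nothing from its neighbours, only the
    identity from the first factor. *)
Definition cyl_d_fun (i j : int) (x : cyl_mod i) : cyl_mod j :=
  (0, cut (j == i + 1) _ (incl _ x.1 + pr (rest (i + 1)) (tot E (incl _ x.2)))).

(** On S the additional components are f from degree b to b - 1 and -1 from b - 1 to b - 2. Their
    composite -f cancels the path from degree b to b - 2 through the neighbours of S, which
    contributes f; this gives h^2 = 0. *)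
Definition cyl_h_fun (i j : int) (x : cyl_mod i) : cyl_mod j :=
  (cut (j == i - 1) _ (f *: incl _ x.2),
   cut (j == i - 1) _ (- incl _ x.1 + pr (new (i - 1)) (tot E (incl _ x.2)))).

Fact cyl_d_linear i j : linear (@cyl_d_fun i j).
Proof.
move=> a x y; congr (_, _); first by rewrite /= scaler0 addr0.
apply: etrans _ (linearP (cut (j == i + 1) (any j)) _ _ _); congr (cut _ _ _).
by rewrite !linearP scalerDr addrACA.
Qed.

Fact cyl_h_linear i j : linear (@cyl_h_fun i j).
Proof.
move=> a x y; congr (_, _).
  apply: etrans _ (linearP (cut (j == i - 1) (top (j + 1))) _ _ _); congr (cut _ _ _).
  by rewrite (linearP (incl _)) scalerDr !scalerA mulrC.
apply: etrans _ (linearP (cut (j == i - 1) (any j)) _ _ _); congr (cut _ _ _).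
rewrite (linearP (incl (top _))) (linearP (incl (any _))) (linearP (tot E)) (linearP (pr _)).
by rewrite scalerDr opprD scalerN addrACA.
Qed.

Definition cyl_d i j : {linear cyl_mod i -> cyl_mod j} := mk_linear (@cyl_d_linear i j).
Definition cyl_h i j : {linear cyl_mod i -> cyl_mod j} := mk_linear (@cyl_h_linear i j).

Fact cyl_d_deg i j x : j != i + 1 -> cyl_d i j x = 0.
Proof.
move=> /negbTE ij; congr (_, _); apply: partP => k _.
by rewrite cutE ij linear0.
Qed.

Fact cyl_h_deg i j x : j != i - 1 -> cyl_h i j x = 0.
Proof.
by move=> /negbTE ij; congr (_, _); apply: partP => k _; rewrite cutE ij linear0.
Qed.

Lemma incl_cyl_d i j x : j = i + 1 ->
  incl _ (cyl_d i j x).2 = incl _ x.1 + pr (rest j) (tot E (incl _ x.2)).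
Proof.
move=> ->; apply: dsumP => k; rewrite cutE eqxx andTb dsumDE prE; case: ifPn => // nU.
rewrite incl0 ?add0r; last by move: nU; rewrite /any /top; lia.
by rewrite ifN //; move: nU; rewrite /any /rest; lia.
Qed.

Lemma incl_cyl_h i j x : j = i - 1 ->
  incl _ (cyl_h i j x).2 = - incl _ x.1 + pr (new j) (tot E (incl _ x.2)).
Proof.
move=> ->; apply: dsumP => k; rewrite cutE eqxx andTb dsumDE prE; case: ifPn => // nU.
rewrite [X in X + _](_ : _ = - (incl _ x.1 k)) //.
rewrite incl0 ?oppr0 ?add0r; last by move: nU; rewrite /any /top; lia.
by rewrite ifN //; move: nU; rewrite /any /new; lia.
Qed.

Lemma S_nb k m : S k -> nb k m -> ~~ S m.
Proof. by move=> Sk km; apply/negP => /r_top; rewrite (r_max Sk km); lia. Qed.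

Lemma tot_top0 n (q : part E (top n)) k : r k != n - 1 -> tot E (incl _ q) k = 0.
Proof.
move=> rk; apply: tot_nb_eq0 => m km; apply: incl0; apply: contra rk => /andP[Sm rm].
have mk : nb m k by move: km; rewrite /nb; lia.
by rewrite (r_max Sm mk) -(r_top Sm) (eqP rm).
Qed.

Lemma tot_topS n (q : part E (top n)) k : S k -> tot E (incl _ q) k = 0.
Proof.
move=> Sk; apply: tot_nb_eq0 => m km; apply: incl0.
by rewrite /top (negbTE (S_nb Sk km)).
Qed.

Fact cyl_dd i j l x : cyl_d j l (cyl_d i j x) = 0.
Proof.
have [->|jl] := eqVneq l (j + 1); last by rewrite cyl_d_deg.
have [->|ij] := eqVneq j (i + 1); last by rewrite [X in cyl_d _ _ X]cyl_d_deg ?linear0.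
congr (_, _); apply: val_inj; apply: etrans (incl_cyl_d _ erefl) _.
rewrite incl_cyl_d // linear0 add0r; apply: dsumP => k; rewrite prE; case: ifPn => // Rk.
rewrite linearD dsumDE tot_top0 ?tot_pr_tot0 ?addr0 //.
  by apply: incl0; move: Rk; rewrite /any /rest; lia.
by move: Rk; rewrite /rest; lia.
Qed.

Lemma r_nb k m : nb k m -> r m = r k + 1 \/ r m = r k - 1.
Proof. exact: walk_nb. Qed.

Lemma nbC k m : nb k m = nb m k.
Proof. by rewrite /nb; lia. Qed.

Fact cyl_hh i j l x : cyl_h j l (cyl_h i j x) = 0.
Proof.
have [->|jl] := eqVneq l (j - 1); last by rewrite cyl_h_deg.
have [->|ij] := eqVneq j (i - 1); last by rewrite [X in cyl_h _ _ X]cyl_h_deg ?linear0.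
congr (_, _).
  apply: partP => k /andP[Sk rk]; rewrite cutE linear0; case: ifP => // _.
  rewrite incl_cyl_h // dsumZE dsumDE prE ifN; last by rewrite /new; lia.
  rewrite addr0 [X in f *: X](_ : _ = - (incl _ x.1 k)) // incl0 ?oppr0 ?scaler0 //.
  by rewrite /top; lia.
apply: val_inj; apply: etrans (incl_cyl_h _ erefl) _.
rewrite incl_cyl_h // linear0; apply: dsumP => k; rewrite dsumDE dsumNE.
rewrite cutE eqxx andTb dsumZE prE linearD dsumDE linearN dsumNE.
have [Sk|nS] := boolP (S k).
  rewrite tot_topS // oppr0 add0r; have [ri|ri] := eqVneq (r k) i; last first.
    by rewrite !ifN ?oppr0 ?addr0 //; move: ri; rewrite /new /top Sk; lia.
  rewrite !ifT ?tot_pr_tot_in ?addNr //; try by rewrite /top /new Sk; lia.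
  by move=> m km; rewrite /new (S_nb Sk km); have := r_nb km; have := r_max Sk km;
    have := r_top Sk; lia.
rewrite ifN ?oppr0 ?add0r; last by rewrite /top (negbTE nS).
case: ifPn => // nk.
have rk : r k = i - 1 - 1 by move: nk; rewrite /new (negbTE nS); lia.
rewrite tot_top0 ?oppr0 ?add0r; last by lia.
by apply: tot_pr_tot0; apply: incl0; rewrite /any (negbTE nS); lia.
Qed.

Fact cyl_dh i x :
  cyl_d (i - 1) i (cyl_h i (i - 1) x) + cyl_h (i + 1) i (cyl_d i (i + 1) x) = f *: x.
Proof.
have e1 : i = i - 1 + 1 by lia.
have e2 : i = i + 1 - 1 by lia.
congr (_, _).
  apply: partP => k /andP[Sk /eqP rk].
  apply: etrans (_ : f *: incl _ (cyl_d i (i + 1) x).2 k = _).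
    rewrite linearD dsumDE [X in X + _](_ : _ = 0) ?add0r; last by rewrite linear0.
    by rewrite cutE -e2 eqxx /top Sk rk eqxx.
  rewrite incl_cyl_d // dsumDE prE ifN ?addr0; last by rewrite /rest Sk.
  by rewrite linearZ.
apply: partP => k Uk.
apply: etrans (_ : incl _ (cyl_d (i - 1) i (cyl_h i (i - 1) x)).2 k
                 + incl _ (cyl_h (i + 1) i (cyl_d i (i + 1) x)).2 k = _).
  by rewrite -dsumDE -linearD.
rewrite [RHS](_ : _ = f *: incl _ x.2 k); last by rewrite -dsumZE -linearZ.
rewrite (@incl_cyl_d (i - 1) i) // (@incl_cyl_h i (i - 1)) //.
rewrite (@incl_cyl_h (i + 1) i) // (@incl_cyl_d i (i + 1)) // !dsumDE dsumNE !prE.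
have -> : incl _ (cyl_d i (i + 1) x).1 k = 0 by exact: (incl_zero (top (i + 1 + 1))).
rewrite oppr0 add0r.
rewrite eqxx andTb dsumZE !linearD !dsumDE linearN dsumNE.
have [Sk|nS] := boolP (S k).
  rewrite [X in _ + X + _]ifN ?addr0; last by rewrite /rest Sk.
  (* In degree b the factor f comes from passing through the first factor; in degree b - 2 it comes
     from the round trip through the neighbours. *)
  rewrite tot_topS // add0r; have [ri|ri] := eqVneq (r k) i.
    rewrite ifT ?ifN ?addr0 //; rewrite /top /new Sk; lia.
  rewrite ifN ?add0r ?ifT; try by move: Uk ri; rewrite /any /top /new Sk; lia.
  apply: tot_pr_tot_in => m km; rewrite /rest (S_nb Sk km).
  by have := r_max Sk km; have := r_top Sk; move: Uk ri; rewrite /any Sk; lia.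
have rk : r k = i by move: Uk; rewrite /any (negbTE nS); lia.
rewrite [X in X + _ + _]ifN ?add0r; last by rewrite /top (negbTE nS).
rewrite !ifT; try by rewrite /rest /new nS; lia.
(* The contributions of the first factor cancel. A neighbour m of k lying in S has r m = i + 1 = (i
   - 1) + 2, so it is counted in [new (i - 1)] and not in [rest (i + 1)]: still exactly once. *)
rewrite addrACA addNr add0r; apply: tot_pr_tot2 => m km; rewrite /new /rest.
have := r_nb km; have [Sm|_ /=] := boolP (S m); last by lia.
rewrite nbC in km; have := r_max Sm km; have := r_top Sm; lia.
Qed.

Definition cyl : kdg f := KDG cyl_d_deg cyl_h_deg cyl_dd cyl_hh cyl_dh.

Lemma cyl_strictly_perfect : strictly_perfect E -> strictly_perfect cyl.
Proof.
move=> pE; split; last first.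
  move=> i; have [f1 p1] := fgp_part (top (i + 1)) pE; have [f2 p2] := fgp_part (any i) pE.
  by split; [exact: fg_prod | exact: projective_prod].
have [s hs] := strictly_perfect_bound pE; have [n hn] := bounded_abs r s.
exists (n + 2)%N => i ni [q t]; congr (_, _); apply: partP => k Qk; rewrite linear0;
  by apply: hs; apply: contraL ni => /hn; move: Qk; rewrite /top /any; lia.
Qed.

(** The first component corrects the inclusion on the neighbours of S: its d restores the arrows
    into degree b that [cyl_d] leaves out, and its h, which is -1, removes the arrows into the copy
    in degree b - 2. *)
Fact iota_linear i : linear (fun x : reg E r i =>
  (cut true (top (i + 1)) (tot E (incl _ x)), cut true (any i) (incl _ x)) : cyl i).
Proof.
by move=> a x y; congr (_, _); rewrite (linearP (incl _)) ?(linearP (tot E)) (linearP (cut _ _)).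
Qed.

Lemma iota2 i x : (mk_linear (@iota_linear i) x).2 = cut true (any i) (incl _ x).
Proof. by []. Qed.

Lemma incl_any i (x : reg E r i) : incl _ (cut true (any i) (incl _ x)) = incl _ x.
Proof.
apply: dsumP => k; rewrite cutE; case: ifPn => //= h; rewrite incl0 //.
by move: h; rewrite /any; lia.
Qed.

Lemma incl_any' i (x : reg E r' i) : incl _ (cut true (any i) (incl _ x)) = incl _ x.
Proof.
apply: dsumP => k; rewrite cutE; case: ifPn => //= h; rewrite incl0 //=.
by move: h; rewrite newE /any /new; lia.
Qed.

Definition iota : kmor (reg E r) cyl.
Proof.
exists (fun i => mk_linear (@iota_linear i)) => i j x.
  have [ij|ij] := eqVneq j (i + 1); last by rewrite !kd_deg // linear0.
  congr (_, _).
    apply: partP => k /andP[_ /eqP rk]; rewrite cutE linear0 incl_reg_d //.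
    by case: ifP => // _; apply: tot_pr_tot0; apply: incl0; lia.
  apply: val_inj; apply: etrans (incl_any _) _; apply: etrans _ (esym (incl_cyl_d _ ij)).
  apply: dsumP => k; rewrite incl_reg_d // dsumDE !prE iota2 incl_any /top /rest -ij andTb.
  by have [Sk|nS] := boolP (S k); case: ifP; rewrite ?addr0 ?add0r.
have [ij|ij] := eqVneq j (i - 1); last by rewrite !kh_deg // linear0.
congr (_, _).
  apply: partP => k /andP[Sk /eqP rk]; rewrite !cutE incl_reg_h // incl_any ij eqxx.
  case: ifP => // _; apply: tot_pr_tot_in => m km.
  by have := r_max Sk km; have := r_top Sk; lia.
apply: val_inj; apply: etrans (incl_any _) _; apply: etrans _ (esym (incl_cyl_h _ ij)).
apply: dsumP => k; rewrite incl_reg_h // dsumDE dsumNE !prE iota2 incl_any /top /new andTb.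
have [Sk|nS] := boolP (S k); last by rewrite oppr0 add0r /= orbF.
rewrite /=; have [ri|ri] := eqVneq (r k) (i + 1).
  by rewrite ifN ?ifT ?addNr //; lia.
rewrite oppr0 add0r [in RHS]ifN; last by lia.
case: ifP => // /eqP rk; apply: tot_nb_eq0 => m km; apply: incl0.
by have := r_max Sk km; have := r_top Sk; lia.
Defined.

Fact psi_linear i : linear (fun x : reg E r' i => (0, cut true (any i) (incl _ x)) : cyl i).
Proof.
move=> a x y; congr (_, _); first by rewrite /= scaler0 addr0.
by rewrite (linearP (incl _)) (linearP (cut _ _)).
Qed.

Lemma psi1 i x : (mk_linear (@psi_linear i) x).1 = 0.
Proof. by []. Qed.

Lemma psi2 i x : (mk_linear (@psi_linear i) x).2 = cut true (any i) (incl _ x).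
Proof. by []. Qed.

Definition psi : kmor (reg E r') cyl.
Proof.
exists (fun i => mk_linear (@psi_linear i)) => i j x.
  have [ij|ij] := eqVneq j (i + 1); last by rewrite !kd_deg // linear0.
  congr (_, _); apply: val_inj; apply: etrans (incl_any' _) _.
  apply: etrans _ (esym (incl_cyl_d _ ij)).
  apply: dsumP => k; rewrite incl_reg_d // psi1 psi2 linear0 add0r !prE incl_any' newE /new /rest.
  have [Sk|nS] := boolP (S k); last by rewrite /= orbF.
  rewrite /=; case: ifP => // /eqP rk; apply: tot_nb_eq0 => m km; apply: incl0.
  by rewrite newE /new (negbTE (S_nb Sk km)) /= orbF; have := r_max Sk km; have := r_top Sk; lia.
have [ij|ij] := eqVneq j (i - 1); last by rewrite !kh_deg // linear0.
congr (_, _).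
  apply: partP => k /andP[Sk /eqP rk]; rewrite cutE linear0 incl_any'; case: ifP => // _.
  by rewrite dsumZE incl0 ?scaler0 // newE /new Sk; lia.
apply: val_inj; apply: etrans (incl_any' _) _; apply: etrans _ (esym (incl_cyl_h _ ij)).
apply: dsumP => k; rewrite incl_reg_h // psi1 psi2 linear0 ?oppr0 add0r !prE incl_any'.
by rewrite newE.
Defined.

(** The cylinder modulo the image of psi consists of E_S in degrees b - 1 and b, with the identity
    as differential. *)
Lemma psi_qis : quasi_iso psi.
Proof.
move=> i; split=> [x dx [[q t] e]|[q t] dy].
  have ei : i = i - 1 + 1 by lia.
  have xE k : incl _ x k = incl _ q k + (if rest i k then tot E (incl _ t) k else 0).
    have := congr1 (fun y : cyl i => incl _ y.2 k) e.
    rewrite incl_cyl_d // dsumDE prE => <-.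
    by rewrite [in RHS]psi2 incl_any'.
  exists (cut true _ (incl _ t)); apply: partP => k r'k.
  rewrite incl_reg_d // prE r'k; move: r'k; rewrite newE => nk.
  have -> : incl _ x k = if rest i k then tot E (incl _ t) k else 0.
    by rewrite xE incl0 ?add0r //; move: nk; rewrite /new /top; lia.
  case: ifPn => Rk.
    apply: tot_nb_eq => m km; rewrite cutE andTb newE; case: ifPn => // nm.
    apply: incl0; rewrite nbC in km.
    move: nm Rk; rewrite /any /new /rest; have [Sm|_ /=] := boolP (S m); last by lia.
    by have := r_max Sm km; have := r_top Sm; lia.
  have Sk : S k by move: nk Rk; rewrite /new /rest; lia.
  apply/esym/tot_nb_eq0 => m km; rewrite cutE; case: ifP => // _.
  apply: incl0; move: nk; rewrite /any /new Sk (negbTE (S_nb Sk km)).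
  by have := r_max Sk km; have := r_top Sk; lia.
have dyE k : incl _ q k + (if rest (i + 1) k then tot E (incl _ t) k else 0) = 0.
  have := congr1 (fun y : cyl (i + 1) => incl _ y.2 k) dy.
  by rewrite incl_cyl_d // linear0.
(* The part of t in the copy of S in degree b is the differential of the same element of the first
   factor; the rest of t comes from psi. *)
exists (cut true _ (incl _ t)), (cut true _ (incl _ t), 0); split.
  apply: partP => k r'k; rewrite incl_reg_d // prE r'k linear0.
  move: r'k; rewrite newE => nk.
  have [Sk|nS] := boolP (S k).
    apply: tot_nb_eq0 => m km; rewrite cutE; case: ifP => // _; apply: incl0.
    move: nk; rewrite /any /new Sk (negbTE (S_nb Sk km)).
    by have := r_max Sk km; have := r_top Sk; lia.
  have := dyE k; rewrite incl0 ?ifT ?add0r; try by move: nk; rewrite /new /top /rest; lia.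
  move=> e; rewrite -[RHS]e; apply: tot_nb_eq => m km; rewrite cutE andTb newE.
  case: ifPn => // nm; apply/esym/incl0; rewrite nbC in km.
  move: nm nk; rewrite /any /new; have [Sm|_ /=] := boolP (S m); last by lia.
  by have := r_max Sm km; have := r_top Sm; lia.
congr (_, _).
  apply: partP => k Tk; rewrite addr0 linear0; have := dyE k.
  by rewrite ifN ?addr0 //; move: Tk; rewrite /top /rest; lia.
apply: partP => k Uk; apply: etrans (_ : incl _ (psi i (cut true _ (incl _ t))).2 k +
   incl _ (cyl_d (i - 1) i (cut true _ (incl _ t), 0)).2 k = _).
  rewrite incl_any' incl_cyl_d; last by lia.
  rewrite dsumDE !prE [tot E _ k](_ : _ = 0); last first.
    by apply: tot_nb_eq0 => m _; exact: (incl_zero (any (i - 1))).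
  rewrite if_same addr0 newE !andTb.
  have [ck|ck] := boolP (new i k).
    by rewrite ifN ?addr0 //; move: ck; rewrite /new /top; lia.
  by rewrite ifT ?add0r //; move: ck Uk; rewrite /new /top /any; lia.
by rewrite -dsumDE -linearD.
Qed.

Lemma cone_iota_dE i j (x : reg E r (i + 1)) (y : cyl i) : j = i + 1 ->
  kd (cone iota) i j (x, y) =
  (- reg_d E r (i + 1) (j + 1) x,
   (cut true (top (j + 1)) (tot E (incl _ x)), cut true (any j) (incl _ x)) + cyl_d i j y).
Proof. by move=> ->; rewrite cone_dE. Qed.

(* Only used for i = b - 1 in [gen_fun], and for i = b - 2 in [gen_h], which is
   then the action of the generator of K(B,f) of degree -1 on [gen_fun]. *)
Definition gen_fun i (q : part E (top b)) : cone iota i :=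
  (cut true _ (- incl _ q), (cut true _ (incl _ q), 0)).

Definition gen_h i (q : part E (top b)) : cone iota i :=
  (cut true _ (tot E (incl _ q)), (0, cut true _ (- incl _ q))).

Fact gen_linear i : linear (@gen_fun i).
Proof.
move=> a x y; congr (_, (_, _)); last by rewrite /= scaler0 addr0.
  by rewrite (linearP (incl _)) opprD -scalerN (linearP (cut _ _)).
by rewrite (linearP (incl _)) (linearP (cut _ _)).
Qed.

Definition gen i : {linear part E (top b) -> cone iota i} := mk_linear (@gen_linear i).

Lemma gen_d i j q : b = i + 1 -> j = i + 1 -> kd (cone iota) i j (gen i q) = 0.
Proof.
move=> bi ji; rewrite cone_iota_dE //; congr (_, (_, _)).
- rewrite -[RHS]oppr0; congr (- _); apply: partP => k /eqP rk.
  rewrite reg_dE linear0; case: ifP => // _; apply: tot_nb_eq0 => m km.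
  rewrite cutE; case: ifP => // _; rewrite dsumNE incl0 ?oppr0 //.
  apply/negP => /andP[Sm _]; rewrite nbC in km.
  by have := r_max Sm km; have := r_top Sm; lia.
- rewrite addr0; apply: partP => k /andP[Sk rk]; have := r_top Sk; lia.
apply: partP => k Uk; rewrite linearD dsumDE cutE.
rewrite [X in _ + X](_ : _ = incl _ q k).
  rewrite cutE andTb Uk dsumNE; case: ifP => [_|rk]; first by rewrite addNr linear0.
  by rewrite add0r linear0 incl0 //; move: rk; rewrite /top bi; lia.
rewrite incl_cyl_d // dsumDE prE [tot E _ k](_ : _ = 0); last first.
  by apply: tot_nb_eq0 => m _; exact: (incl_zero (any i)).
rewrite if_same addr0 cutE /top -bi; case: ifPn => // rk; rewrite incl0 //.
Qed.

Lemma gen_h0 i : gen_h i 0 = 0.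
Proof.
congr (_, (_, _)); apply: partP => k _; rewrite cutE incl_zero; case: ifP => // _.
  by apply: tot_nb_eq0 => m _; exact: incl_zero.
by rewrite dsumNE incl_zero oppr0.
Qed.

Lemma gen_hE i j q : b = i + 1 -> j = i - 1 -> kh (cone iota) i j (gen i q) = gen_h j q.
Proof.
move=> bi ji; congr (_, (_, _)).
- apply: partP => k /eqP rk.
  apply: etrans (_ : - incl _ (reg_h E r (i + 1) (j + 1) (cut true _ (- incl _ q))) k = _).
    exact: erefl.
  rewrite incl_reg_h; last by lia.
  rewrite prE cutE andTb rk eqxx -dsumNE -linearN; apply: tot_nb_eq => m _.
  rewrite dsumNE cutE andTb dsumNE; case: ifPn => [_|rm]; first by rewrite opprK.
  by rewrite oppr0 incl0 // /top; lia.
- apply: partP => k _; rewrite cutE [RHS]incl_zero; case: ifP => // _.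
  by rewrite dsumZE [X in f *: X](incl_zero (any i)) scaler0.
apply: partP => k Uk; rewrite cutE ji eqxx andTb -ji Uk cutE Uk.
rewrite dsumDE dsumNE prE [tot E _ k](_ : _ = 0); last first.
  by apply: tot_nb_eq0 => m _; exact: (incl_zero (any i)).
rewrite if_same addr0 cutE dsumNE andTb -bi; case: ifPn => // rk.
by rewrite incl0.
Qed.

(** Injectivity of [gen_map] on cohomology in degree 0. On S the first factor gives q = (d + h) x,
    and on the neighbours of S one has x = -(d + h) t; the round trip yields q = -f t. *)
Lemma gen_boundary i j q w : j = i + 1 -> b = j + 1 ->
  gen j q = kd (cone iota) i j w -> exists t, q = f *: t.
Proof.
case: w => x [q' t] ji bj; rewrite cone_iota_dE // => e.
have e1 : cut true (top (j + 1)) (incl _ q) = cut true (top (j + 1)) (tot E (incl _ x)) + 0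
  by exact: (congr1 (fun z : cone iota j => z.2.1) e).
have e2 : 0 = cut true (any j) (incl _ x) + (cyl_d i j (q', t)).2
  by exact: (congr1 (fun z : cone iota j => z.2.2) e).
exists (cut true _ (- incl _ t)).
apply: partP => k /andP[Sk rk].
have {}e1 : incl _ q k = tot E (incl _ x) k.
  have := congr1 (fun y : part E (top (j + 1)) => incl _ y k) e1.
  by rewrite addr0 !cutE -bj /top Sk rk.
have {}e2 m : any j m ->
    incl _ x m + incl _ q' m + (if rest j m then tot E (incl _ t) m else 0) = 0.
  move=> Um; have := congr1 (fun y : part E (any j) => incl _ y m) e2.
  rewrite linear0 linearD dsumDE cutE andTb Um incl_cyl_d // dsumDE prE addrA => <- //.
rewrite linearZ dsumZE cutE andTb /top Sk rk dsumNE scalerN e1.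
apply: etrans (_ : tot E (- pr (rest j) (tot E (incl _ t))) k = _).
  apply: tot_nb_eq => m km; rewrite dsumNE prE.
  have rm : r m = j by have := r_max Sk km; lia.
  have := e2 m; rewrite /any rm eqxx => /(_ isT).
  rewrite [incl _ q' m]incl0 ?addr0; last by rewrite /top (negbTE (S_nb Sk km)).
  by move=> /addr0_eqN.
rewrite linearN dsumNE tot_pr_tot_in // => m km.
by rewrite /rest (S_nb Sk km); have := r_max Sk km; lia.
Qed.

(** Injectivity of [gen_map] in degree -1: no boundary of the cone has a component in the copy of S
    in degree b - 2. *)
Lemma gen_h_boundary i j q w : j = i + 1 -> b = j + 1 + 1 ->
  gen_h j q = kd (cone iota) i j w -> q = 0.
Proof.
case: w => x [q' t] ji bj; rewrite cone_iota_dE // => e'.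
have e : cut true (any j) (- incl _ q) = cut true (any j) (incl _ x) + (cyl_d i j (q', t)).2
  by exact: (congr1 (fun z : cone iota j => z.2.2) e').
apply: partP => k /andP[Sk rk]; rewrite linear0.
have Uk : any j k by rewrite /any Sk; lia.
have := congr1 (fun y : part E (any j) => incl _ y k) e.
rewrite linearD dsumDE incl_cyl_d // dsumDE prE !cutE !andTb Uk dsumNE.
rewrite [incl _ x k]incl0; last by lia.
rewrite [incl _ q' k]incl0; last by rewrite /top; lia.
by rewrite ifN ?addr0 ?add0r => [/oppr0_eq|]; rewrite // /rest Sk.
Qed.

(** Surjectivity of [gen_map] on cohomology, in all degrees at once: the side conditions leave q
    only for j = b - 1, and t, which is then killed by f, only for j = b - 2. *)
Lemma gen_cocycle i j l y : j = i + 1 -> l = j + 1 -> kd (cone iota) j l y = 0 ->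
  exists w (q t : part E (top b)),
    [/\ j + 1 != b -> q = 0, j + 2 != b -> t = 0, j + 2 = b -> f *: t = 0
      & y = gen j q + gen_h j t + kd (cone iota) i j w].
Proof.
case: y => x [q t] ji lj; rewrite cone_iota_dE // => e.
have e1 : cut true (top (l + 1)) (tot E (incl _ x)) + 0 = 0
  by exact: (congr1 (fun z : cone iota l => z.2.1) e).
have e2 : cut true (any l) (incl _ x) + (cyl_d j l (q, t)).2 = 0
  by exact: (congr1 (fun z : cone iota l => z.2.2) e).
have {}e1 k : top (l + 1) k -> tot E (incl _ x) k = 0.
  by move=> Tk; have := congr1 (fun y => incl _ y k) e1; rewrite addr0 cutE andTb Tk incl_zero.
have {}e2 k : any l k -> incl _ x k + incl _ q k + (if rest l k then tot E (incl _ t) k else 0) = 0.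
  move=> Uk; have := congr1 (fun y => incl _ y k) e2.
  by rewrite incl_zero linearD dsumDE incl_cyl_d // dsumDE prE cutE andTb Uk addrA.
(* Subtracting the boundary of t0 removes the part of t that is graded by r. What remains is q1 in
   the first factor and -t1 in the copy of S in degree b - 2; the cocycle condition then determines
   the remaining component. *)
pose t0 : part E (fun k => r k == i + 1) := cut true _ (incl _ t).
pose q1 : part E (top b) := cut true _ (incl _ q - pr (top (j + 1)) (tot E (incl _ t0))).
pose t1 : part E (top b) := cut true _ (- pr (top (j + 2)) (incl _ t)).
have tE : incl _ t = incl _ t0 - incl _ t1.
  apply: dsumP => m; rewrite dsumDE dsumNE !cutE !andTb dsumNE prE.
  have [Sm|nS] := boolP (S m); last first.
    rewrite /top (negbTE nS) /= oppr0 addr0; case: ifPn => // rm.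
    by apply: incl0; rewrite /any (negbTE nS) ji; lia.
  have rm := r_top Sm; rewrite /top Sm rm eqxx /= -ji.
  have [bj|bj] := eqVneq b j.
    by rewrite ifN ?oppr0 ?addr0 ?subr0 //; lia.
  rewrite add0r; case: ifPn => [_|bj2]; first by rewrite opprK.
  by rewrite !oppr0; apply: incl0; rewrite /any Sm rm; lia.
have q1E k : top (j + 1) k -> incl _ q1 k = incl _ q k - tot E (incl _ t0) k.
  move=> /[dup] Tk /andP[Sk rk]; rewrite cutE andTb /top Sk r_top // eqxx.
  by rewrite dsumDE dsumNE prE Sk rk.
exists (t0, (0, 0)), q1, t1; split.
- move=> jb; apply: partP => k /andP[Sk /eqP rk]; rewrite incl_zero cutE andTb.
  case: ifP => // _; rewrite dsumDE dsumNE prE incl0 ?ifN ?subr0 // /top; lia.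
- move=> jb; apply: partP => k /andP[Sk /eqP rk]; rewrite incl_zero cutE andTb.
  by case: ifP => // _; rewrite dsumNE prE ifN ?oppr0 // /top; lia.
(* The cocycle condition gives x = -(d + h) t on the neighbours of S and (d + h) x = 0 on S, so the
   round trip gives f t = 0 there. *)
- move=> jb; apply: partP => k /andP[Sk /eqP rk]; rewrite incl_zero linearZ dsumZE.
  rewrite cutE andTb /top Sk rk eqxx dsumNE prE /top Sk rk jb eqxx scalerN.
  rewrite -(@tot_pr_tot_in _ _ _ (rest l)); last first.
    by move=> m km; rewrite /rest (S_nb Sk km); have := r_max Sk km; lia.
  rewrite -dsumNE -linearN -[RHS](e1 k); last by rewrite /top Sk; lia.
  apply: tot_nb_eq => m km; rewrite dsumNE prE.
  have rm := r_max Sk km; have := e2 m; rewrite /any.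
  rewrite [incl _ q m]incl0; last by rewrite /top (negbTE (S_nb Sk km)).
  by rewrite addr0 => h; rewrite [RHS](addr0_eqN (h _)) //; lia.
clearbody t0 q1 t1; congr (_, (_, _)).
- apply: partP => k /eqP rk.
  apply: etrans (_ : incl _ (cut true (fun m => r m == j + 1) (- incl _ q1)) k +
    incl _ (cut true (fun m => r m == j + 1) (tot E (incl _ t1))) k
     - incl _ (reg_d E r (i + 1) (j + 1) t0) k = _); last first.
    by [].
  have ji' : j + 1 == i + 1 + 1 by lia.
  rewrite reg_dE !cutE !andTb rk eqxx ji' !andTb dsumNE.
  have := e2 k; rewrite /any lj rk eqxx => /(_ isT).
  have [Sk|nS] := boolP (S k).
    rewrite ifN ?addr0 => [/addr0_eqN ->|]; last by rewrite /rest Sk.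
    rewrite q1E; last by rewrite /top Sk rk eqxx.
    rewrite [tot E (incl _ t1) k]tot_topS // addr0 opprB.
    by rewrite [in RHS]addrC addrA addNr add0r.
  rewrite [incl _ q k]incl0 ?addr0; last by rewrite /top (negbTE nS).
  rewrite [incl _ q1 k]incl0 ?oppr0 ?add0r; last by rewrite /top (negbTE nS).
  rewrite ifT; last by rewrite /rest nS rk eqxx.
  by rewrite tE linearD dsumDE linearN dsumNE => /addr0_eqN ->; rewrite opprB.
- apply: partP => k Tk.
  apply: etrans (_ : incl _ (cut true (top (j + 1)) (incl _ q1)) k + 0
     + (incl _ (cut true (top (j + 1)) (tot E (incl _ t0))) k + 0) = _); last first.
    by rewrite [in RHS]cone_iota_dE.
  by rewrite !cutE !andTb Tk !addr0 q1E // subrK.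
- apply: partP => k Uk.
  apply: etrans (_ : 0 + incl _ (cut true (any j) (- incl _ t1)) k
     + (incl _ (cut true (any j) (incl _ t0)) k + incl _ (cyl_d i j (0, 0)).2 k) = _); last first.
    by rewrite [in RHS]cone_iota_dE // -(incl_zero (any j) k).
  rewrite (_ : cyl_d i j (0, 0) = 0); last exact: (linear0 (cyl_d i j)).
  rewrite [X in _ + (_ + X)](incl_zero (any j)).
  by rewrite !cutE !andTb Uk add0r addr0 tE dsumDE !dsumNE [LHS]addrC.
Qed.

Fact gen_shift_d x : kd (shift (b - 1) (cone iota)) 0 1 (gen (0 + (b - 1)) x) = 0.
Proof. by apply: gen_d; lia. Qed.

(** The generators of the cone lie in degree b - 1 and those of the free module in degree 0: hence
    the shift. *)
Definition gen_map : kmor (free f (part E (top b))) (shift (b - 1) (cone iota)) :=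
  free_map gen_shift_d.

(** The free module on X has cohomology X/fX in degree 0 and the f-torsion of X in degree -1, which
    is what the preceding lemmas find in the cone in degrees b - 1 and b - 2. *)
Lemma gen_map_qis : quasi_iso gen_map.
Proof.
have z i : i != 0 -> i != Negz 0 -> forall x : free f (part E (top b)) i, x = 0.
  by case: i => [[|i]|[|i]] // _ _ x; exact: thinmx0.
move=> i; have [->|i0] := eqVneq i 0.
  split=> [x _ [w e]|y dy].
    by apply: (gen_boundary _ _ e); lia.
  have [||w [q [t [_ t0 _ ->]]]] := gen_cocycle (i := 0 - 1 + (b - 1)) _ _ dy; try by lia.
  exists q, w; split=> //; rewrite t0; last by lia.
  by rewrite [gen_h _ 0](_ : _ = 0) ?addr0 //; exact: gen_h0.
have [->|i1] := eqVneq i (Negz 0).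
  have vE x : gen_map (Negz 0) x = gen_h (Negz 0 + (b - 1)) x.
    by apply: gen_hE; lia.
  split=> [x _ [w]|y dy].
    by rewrite vE => /gen_h_boundary -> //; [exists 0; rewrite linear0 | lia | lia].
  have [||w [q [t [q0 _ ft ->]]]] := gen_cocycle (i := Negz 0 - 1 + (b - 1)) _ _ dy; try by lia.
  exists t, w; split; first by apply: ft; lia.
  by rewrite q0 ?linear0 ?add0r ?vE //; lia.
split=> [x _ _|y dy]; first by exists 0; rewrite linear0; exact: z.
have [||w [q [t [q0 t0 _ ->]]]] := gen_cocycle (i := i - 1 + (b - 1)) _ _ dy; try by lia.
exists 0, w; rewrite !linear0; split=> //.
rewrite q0 ?t0; try by move: i0 i1; lia.
by rewrite linear0 gen_h0 addr0.
Qed.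

Lemma perfect_cone_iota : strictly_perfect E -> perfect (cone iota).
Proof.
move=> pE; apply/(perfect_shift (b - 1)); apply: perf_qis gen_map_qis _.
by apply: perfect_free; have [] := fgp_part (top b) pE.
Qed.

End Cylinder.
End Flip.

(** * Functoriality of the cylinder *)

Section CylinderMap.
Variables (B : comPzRingType) (f : B) (r r' : walk) (S : pred int) (b : int).
Hypothesis r_top : forall k, S k -> r k = b.
Hypothesis r_max : forall k m, S k -> nb k m -> r m = b - 1.
Hypothesis r'E : forall k, r' k = if S k then r k - 2 else r k.
Variables (E E' : kdg f) (u : kmor E E').

Let cylE := cyl r_top r_max E.
Let cylE' := cyl r_top r_max E'.

Fact cyl_map_linear i :
  linear (fun x : cylE i => (part_map u _ x.1, part_map u _ x.2) : cylE' i).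
Proof. by move=> a x y; congr (_, _); rewrite (linearP (part_map u _)). Qed.

Definition cyl_map : kmor cylE cylE'.
Proof.
exists (fun i => mk_linear (@cyl_map_linear i)) => i j x.
  congr (_, _); first exact: linear0.
  apply: etrans (part_map_cut _ _ _ _) _; congr (cut _ _ _).
  by rewrite (linearD (dsum_map u)) dsum_map_pr dsum_map_totE !incl_part_map.
congr (_, _); apply: etrans (part_map_cut _ _ _ _) _; congr (cut _ _ _).
  by rewrite linearZ !incl_part_map.
rewrite (linearD (dsum_map u)) (linearN (dsum_map u)) dsum_map_pr dsum_map_totE.
by rewrite !incl_part_map.
Defined.

Lemma cyl_map_iota i x :
  cyl_map i (iota r_top r_max E i x) = iota r_top r_max E' i (reg_map u r i x).
Proof.
congr (_, _); apply: etrans (part_map_cut _ _ _ _) _; congr (cut _ _ _).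
  by rewrite dsum_map_totE incl_part_map.
by rewrite incl_part_map.
Qed.

Lemma cyl_map_psi i x :
  cyl_map i (psi r_top r_max r'E E i x) = psi r_top r_max r'E E' i (reg_map u r' i x).
Proof.
congr (_, _); first exact: linear0.
apply: etrans (part_map_cut _ _ _ _) _; congr (cut _ _ _).
by rewrite incl_part_map.
Qed.

End CylinderMap.

(** * Walks that fix the support of a module *)

Section Unregrade.
Variables (B : comPzRingType) (f : B) (r : walk).

Definition fixes (E : kdg f) : Prop := forall k, r k != k -> forall x : E k, x = 0.

Section Map.
Variables (E : kdg f) (hE : fixes E).

Fact kappa_linear i : linear (fun x : E i => cut true _ (dsum_inj E i x) : reg E r i).
Proof. by move=> a x y; rewrite (linearP (dsum_inj E i)) (linearP (cut _ _)). Qed.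

Lemma incl_kappa i x k : incl _ (mk_linear (@kappa_linear i) x) k = transport k x.
Proof.
rewrite cutE; case: ifPn => //= rk; have [ik|ik] := eqVneq i k.
  by apply/esym/hE; apply: contra rk => /eqP ->; rewrite ik.
by rewrite transport_neq.
Qed.

Definition kappa : kmor E (reg E r).
Proof.
exists (fun i => mk_linear (@kappa_linear i)) => i j x; apply: partP => k /eqP rk.
  rewrite incl_kappa; have [rkk|/hE z] := eqVneq (r k) k; last by rewrite [LHS]z [RHS]z.
  rewrite reg_dE -rk rkk eqxx andbT; case: ifP => [/eqP ik|ij].
    rewrite /= /tot_val !incl_kappa ik addrK transport_id transport_id.
    by rewrite [X in kh _ _ _ X]transport_neq ?linear0 ?addr0 //; lia.
  by rewrite kd_deg ?transport0 // ij.
rewrite incl_kappa; have [rkk|/hE z] := eqVneq (r k) k; last by rewrite [LHS]z [RHS]z.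
rewrite reg_hE -rk rkk eqxx andbT; case: ifP => [/eqP ik|ij].
  rewrite /= /tot_val !incl_kappa ik subrK transport_id transport_id.
  by rewrite [X in kd _ _ _ X]transport_neq ?linear0 ?add0r //; lia.
by rewrite kh_deg ?transport0 // ij.
Defined.

Lemma kappaE i x k : incl _ (kappa i x) k = transport k x.
Proof. exact: incl_kappa. Qed.

Lemma bij_qis (X Y : kdg f) (u : kmor X Y) :
  (forall i, injective (u i)) -> (forall i y, exists x, u i x = y) -> quasi_iso u.
Proof.
move=> ui us; apply: bij_quasi_iso => i.
pose v y := projT1 (cid (us i y)).
have vK : cancel v (u i) by move=> y; exact: projT2 (cid (us i y)).
by exists v; split=> // x; apply: (ui i); rewrite vK.
Qed.

Lemma kappa_qis : quasi_iso kappa.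
Proof.
apply: bij_qis => i.
  have h z : incl _ (kappa i z) i = z by rewrite kappaE transport_id.
  by move=> x y e; rewrite -[x]h e h.
move=> y; exists (incl _ y i); apply: partP => k /eqP rk; rewrite kappaE.
have [<-|ik] := eqVneq i k; first by rewrite transport_id.
by rewrite [LHS]hE ?[RHS]hE // rk.
Qed.

End Map.

Lemma kappa_nat (E E' : kdg f) (hE : fixes E) (hE' : fixes E') (u : kmor E E') i x :
  reg_map u r i (kappa hE i x) = kappa hE' i (u i x).
Proof.
apply: partP => k rk; rewrite incl_part_map kappaE.
rewrite -[LHS]/(u k (incl _ (kappa hE i x) k)) kappaE.
have [<-|ik] := eqVneq i k; first by rewrite !transport_id.
by rewrite !transport_neq ?linear0.
Qed.

End Unregrade.

(** * Natural isomorphisms between regradings in Sing(B,f) *)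

Section Sing.
Variables (B : comPzRingType) (f : B).
Implicit Types E F G : cohs f.

(** The zero homotopy suffices, so the records of maps themselves never have to be compared. *)
Lemma sing_map_ext E F (u v : kmor E F) :
  (forall i x, u i x = v i x) -> sing_eq (sing_map u) (sing_map v).
Proof.
move=> uv; apply: sing_homotopic; exists (fun i j => \0 : {linear E i -> F j}).
split=> [//|i x|i x] /=.
  by apply/esym/eqP; rewrite oppr_eq0; apply/eqP; exact: (linear0 (kh F _ _)).
rewrite addr0 uv subrr; apply/esym; exact: (linear0 (kd F _ _)).
Qed.

Lemma sing_congl E F G (a a' : sing_hom F G) (b : sing_hom E F) :
  sing_eq a a' -> sing_eq (sing_comp a b) (sing_comp a' b).
Proof. by move=> h; apply: sing_congr => //; exact: sing_refl. Qed.

Lemma sing_congr_r E F G (a : sing_hom F G) (b b' : sing_hom E F) :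
  sing_eq b b' -> sing_eq (sing_comp a b) (sing_comp a b').
Proof. by move=> h; apply: sing_congr => //; exact: sing_refl. Qed.

Lemma sing_cancel E F G (s : sing_hom F E) (t : sing_hom E F) (a : sing_hom G E) :
  sing_eq (sing_comp s t) (sing_id E) -> sing_eq (sing_comp s (sing_comp t a)) a.
Proof.
move=> st; apply: sing_trans (sing_assoc _ _ _) _.
by apply: sing_trans (sing_congl _ st) _; exact: sing_idl.
Qed.

Lemma sing_cancelr E F G (s : sing_hom F E) (t : sing_hom E F) (a : sing_hom E G) :
  sing_eq (sing_comp s t) (sing_id E) -> sing_eq (sing_comp (sing_comp a s) t) a.
Proof.
move=> st; apply: sing_trans (sing_sym (sing_assoc _ _ _)) _.
by apply: sing_trans (sing_congr_r _ st) _; exact: sing_idr.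
Qed.

Lemma sing_equivalence_comp E F G (a : sing_hom F G) (b : sing_hom E F) :
  sing_equivalence a -> sing_equivalence b -> sing_equivalence (sing_comp a b).
Proof.
move=> [a' [a'a aa']] [b' [b'b bb']]; exists (sing_comp b' a'); split.
  apply: sing_trans (sing_sym (sing_assoc _ _ _)) _.
  exact: sing_trans (sing_congr_r _ (sing_cancel _ a'a)) b'b.
apply: sing_trans (sing_sym (sing_assoc _ _ _)) _.
exact: sing_trans (sing_congr_r _ (sing_cancel _ bb')) aa'.
Qed.

Lemma sing_equivalence_map E F (s : kmor E F) :
  perfect (cone s) -> sing_equivalence (sing_map s).
Proof.
by move=> ps; exists (sing_inv ps); split; [exact: sing_invl | exact: sing_invr].
Qed.

Lemma sing_equivalence_inv E F (s : kmor E F) (ps : perfect (cone s)) :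
  sing_equivalence (sing_inv ps).
Proof.
by exists (sing_map s); split; [exact: sing_invr | exact: sing_invl].
Qed.

Lemma sing_square_inv E F E' F' (s : sing_hom E F) (s' : sing_hom E' F')
    (t : sing_hom F E) (t' : sing_hom F' E') (a : sing_hom E E') (b : sing_hom F F') :
  sing_eq (sing_comp s t) (sing_id F) -> sing_eq (sing_comp t' s') (sing_id E') ->
  sing_eq (sing_comp s' a) (sing_comp b s) ->
  sing_eq (sing_comp t' b) (sing_comp a t).
Proof.
move=> st t's' sq; apply: sing_trans (sing_congr_r _ (sing_sym (sing_cancelr b st))) _.
apply: sing_trans (sing_congr_r _ (sing_congl _ (sing_sym sq))) _.
apply: sing_trans (sing_congr_r _ (sing_sym (sing_assoc _ _ _))) _.
exact: sing_cancel.
Qed.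

Lemma sing_square_comp E F G E' F' G' (s : sing_hom E F) (s' : sing_hom E' F')
    (t : sing_hom F G) (t' : sing_hom F' G')
    (a : sing_hom E E') (b : sing_hom F F') (c : sing_hom G G') :
  sing_eq (sing_comp s' a) (sing_comp b s) ->
  sing_eq (sing_comp t' b) (sing_comp c t) ->
  sing_eq (sing_comp (sing_comp t' s') a) (sing_comp c (sing_comp t s)).
Proof.
move=> sq1 sq2; apply: sing_trans (sing_sym (sing_assoc _ _ _)) _.
apply: sing_trans (sing_congr_r _ sq1) _; apply: sing_trans (sing_assoc _ _ _) _.
by apply: sing_trans (sing_congl _ sq2) _; exact/sing_sym/sing_assoc.
Qed.

Lemma sing_map_square E F E' F' (s : kmor E F) (s' : kmor E' F') (a : kmor E E') (b : kmor F F') :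
  (forall i x, s' i (a i x) = b i (s i x)) ->
  sing_eq (sing_comp (sing_map s') (sing_map a)) (sing_comp (sing_map b) (sing_map s)).
Proof.
move=> h; apply: sing_trans (sing_map_comp _ _) _; apply: sing_sym.
apply: sing_trans (sing_map_comp _ _) _; apply: sing_map_ext => i x; exact: esym (h i x).
Qed.

Definition ckappa r E (hE : fixes r E) : sing_hom E (creg r E) :=
  sing_map (E := E) (E' := creg r E) (kappa hE).

Definition creg_map r E F (u : kmor E F) : sing_hom (creg r E) (creg r F) :=
  sing_map (E := creg r E) (E' := creg r F) (reg_map u r).

(** The third condition says that t is the identity, up to the identifications [kappa], on a module
    that both walks leave in place. It yields the independence of the starting window. *)
Definition regraded (r r' : walk) : Prop :=
  exists t : forall E, sing_hom (creg r E) (creg r' E),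
  [/\ forall E, sing_equivalence (t E),
      forall E F (u : kmor E F),
        sing_eq (sing_comp (t F) (creg_map r u)) (sing_comp (creg_map r' u) (t E))
    & forall E (h : fixes r E) (h' : fixes r' E),
        sing_eq (sing_comp (t E) (ckappa h)) (ckappa h')].

Lemma regraded_sym r r' : regraded r r' -> regraded r' r.
Proof.
move=> [t [te tn tk]]; pose t' E := projT1 (cid (te E)).
have t't E : sing_eq (sing_comp (t' E) (t E)) (sing_id _) by case: (projT2 (cid (te E))).
have tt' E : sing_eq (sing_comp (t E) (t' E)) (sing_id _) by case: (projT2 (cid (te E))).
exists t'; split=> [E|E F u|E h h']; first by exists (t E).
  by apply: sing_square_inv (tt' E) (t't F) _; exact: tn.
by apply: sing_trans (sing_congr_r _ (sing_sym (tk E h' h))) _; exact: sing_cancel.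
Qed.

Lemma regraded_flip (r r' : walk) (S : pred int) (b : int) :
  (forall k, S k -> r k = b) -> (forall k m, S k -> nb k m -> r m = b - 1) ->
  (forall k, r' k = if S k then r k - 2 else r k) -> regraded r r'.
Proof.
move=> r_top r_max r'E.
pose C E : cohs f := CohS (cyl_strictly_perfect r_top r_max (coh_sperf E)).
pose io E : kmor (creg r E) (C E) := iota r_top r_max E.
pose ps E : kmor (creg r' E) (C E) := psi r_top r_max r'E E.
have pio E : perfect (cone (io E)) by apply: perfect_cone_iota; exact: coh_sperf.
have pps E : perfect (cone (ps E)) by exact/perfect_cone_qis/psi_qis.
exists (fun E => sing_comp (sing_inv (pps E)) (sing_map (io E))); split.
- move=> E; apply: sing_equivalence_comp; first exact: sing_equivalence_inv.
  exact: sing_equivalence_map.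
- move=> E F u; pose cu : sing_hom (C E) (C F) :=
    sing_map (E := C E) (E' := C F) (cyl_map r_top r_max u).
  apply: (@sing_square_comp _ _ _ _ _ _ _ _ _ _ _ cu).
    by apply: (sing_map_square (E := creg r E) (F := C E) (E' := creg r F) (F' := C F)) => i x;
      rewrite cyl_map_iota.
  apply: sing_square_inv (sing_invr _) (sing_invl _) _.
  by apply: (sing_map_square (E := creg r' E) (F := C E) (E' := creg r' F) (F' := C F)) => i x;
    rewrite (cyl_map_psi r_top r_max r'E).
move=> E h h'; apply: sing_trans (sing_sym (sing_assoc _ _ _)) _.
apply: sing_trans (_ : sing_eq _ (sing_comp (sing_inv (pps E))
    (sing_comp (sing_map (ps E)) (ckappa h')))) _;
  last exact/sing_cancel/sing_invl.
apply: sing_congr_r; apply: sing_trans (sing_map_comp _ _) _; apply: sing_sym.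
apply: sing_trans (sing_map_comp _ _) _; apply: sing_map_ext => i x.
(* r and r' differ on S, so they cannot both fix a degree in S: a module fixed by both vanishes
   there, and so does the correction term of iota. *)
have Sz k (y : E k) : S k -> y = 0.
  move=> Sk; have [rk|rk] := boolP (r k == k); last exact: (h k rk).
  by apply: h'; rewrite r'E Sk (eqP rk); lia.
congr (_, _); apply: partP => k Qk.
  rewrite incl_zero; case/andP: Qk => Sk _; apply/esym; exact: Sz.
rewrite !cutE; congr (if _ then _ else _).
exact: etrans (kappaE h' _ _) (esym (kappaE h _ _)).
Qed.

End Sing.

(** * Clamped identity walks *)

Section Clamp.
Variables a c : int.

(* The identity on [a, c], continued by alternating steps within [a, c]. *)
Definition clamp_fun (k : int) : int :=
  if (k < a)%R then a + (odd `|k - a|%N)%:Z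
  else if (c < k)%R then c - (odd `|k - c|%N)%:Z else k.

Hypothesis ac : (a < c)%R.

Fact clamp_walk k :
  clamp_fun (k + 1) = clamp_fun k + 1 \/ clamp_fun (k + 1) = clamp_fun k - 1.
Proof.
rewrite /clamp_fun; case: (ltP k a) => h1; case: (ltP (k + 1) a) => h2;
  case: (ltP c k) => h3; case: (ltP c (k + 1)) => h4; try lia.
Qed.

Definition clamp : walk := Walk clamp_walk.

End Clamp.

(** * Shrinking the window down to the degrees -1 and 0 *)

Section Chain.
Variables (B : comPzRingType) (f : B).

(** Beyond the window the larger walk alternates between c + 1 and c. Lowering every value c + 1 by
    2 turns this into the alternation between c - 1 and c of the smaller walk. *)
Lemma regraded_clamp_top a c c' (ac : (a < c)%R) (ac' : (a < c')%R) :
  c' = c + 1 -> regraded f (clamp ac') (clamp ac).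
Proof.
move=> e; move: ac'; rewrite e => ac'.
apply: (@regraded_flip _ _ _ _ (fun k => clamp_fun a (c + 1) k == c + 1) (c + 1)).
- by move=> k /eqP.
- move=> k m /eqP; rewrite /= /clamp_fun /nb.
  case: (ltP k a) => h1; case: (ltP m a) => h2;
    case: (ltP (c + 1) k) => h3; case: (ltP (c + 1) m) => h4; lia.
- move=> k; rewrite /= /clamp_fun.
  case: (ltP k a) => h1; case: (ltP (c + 1) k) => h2; case: (ltP c k) => h3; case: ifP => h4; lia.
Qed.

(** A flip only lowers values, so at the lower end it goes from the smaller window to the larger
    one: S is where the larger walk takes the value a - 1, and there the smaller one has its local
    maxima a + 1. *)
Lemma regraded_clamp_bottom a a' c (ac : (a < c)%R) (ac' : (a' < c)%R) :
  a' = a - 1 -> regraded f (clamp ac) (clamp ac').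
Proof.
move=> e; move: ac'; rewrite e => ac'.
apply: (@regraded_flip _ _ _ _ (fun k => clamp_fun (a - 1) c k == a - 1) (a + 1)).
- move=> k /eqP; rewrite /= /clamp_fun.
  case: (ltP k a) => h1; case: (ltP k (a - 1)) => h2; case: (ltP c k) => h3; lia.
- move=> k m /eqP; rewrite /= /clamp_fun /nb.
  case: (ltP k (a - 1)) => h1; case: (ltP m a) => h2;
    case: (ltP c k) => h3; case: (ltP c m) => h4; lia.
- move=> k; rewrite /= /clamp_fun.
  case: (ltP k a) => h1; case: (ltP k (a - 1)) => h2; case: (ltP c k) => h3; case: ifP => h4; lia.
Qed.

Fact window_lt (m : nat) : (- 1 - m%:Z < m%:Z)%R. Proof. lia. Qed.

(** The asymmetry makes [window 0] the interval [-1, 0], the two degrees of the fold. *)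
Definition window m : walk := clamp (window_lt m).

Definition bounded m (E : kdg f) : Prop :=
  forall k, (m < `|k|)%N -> forall x : E k, x = 0.

Lemma fixes_clamp m E a c (ac : (a < c)%R) :
  bounded m E -> (a <= - m%:Z)%R -> (m%:Z <= c)%R -> fixes (clamp ac) E.
Proof.
move=> bE am mc k; rewrite /= /clamp_fun => h; apply: bE; move: h.
by case: (ltP k a) => h1; case: (ltP c k) => h2; lia.
Qed.

Lemma fixes_window m n E : bounded m E -> (m <= n)%N -> fixes (window n) E.
Proof. by move=> bE mn; apply: fixes_clamp bE _ _; lia. Qed.

(** One move at each end of the window. The bound on E ensures that the intermediate walk fixes E
    too, so the two compatibilities with [kappa] compose. *)
Lemma step_ex m : exists t : forall E : cohs f, sing_hom (creg (window m.+1) E) (creg (window m) E),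
  [/\ forall E, sing_equivalence (t E),
      forall (E F : cohs f) (u : kmor E F),
        sing_eq (sing_comp (t F) (creg_map _ u)) (sing_comp (creg_map _ u) (t E))
    & forall (E : cohs f) (h : fixes (window m.+1) E) (h' : fixes (window m) E), bounded m E ->
        sing_eq (sing_comp (t E) (ckappa h)) (ckappa h')].
Proof.
have ac : (- 1 - m.+1%:Z < m%:Z)%R by lia.
have [t [te tn tk]] : regraded f (window m.+1) (clamp ac).
  by apply: regraded_clamp_top; lia.
have [s [se sn sk]] : regraded f (clamp ac) (window m).
  by apply: regraded_sym; apply: regraded_clamp_bottom; lia.
exists (fun E => sing_comp (s E) (t E)); split.
- by move=> E; exact: sing_equivalence_comp.
- by move=> E F u; apply: sing_square_comp; [exact: tn | exact: sn].
move=> E h h' bE; have h2 : fixes (clamp ac) E by apply: fixes_clamp bE _ _; lia.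
apply: sing_trans (sing_sym (sing_assoc _ _ _)) _.
exact: sing_trans (sing_congr_r _ (tk E h h2)) (sk E h2 h').
Qed.

Definition step m := projT1 (cid (step_ex m)).

Fixpoint chain m (E : cohs f) : sing_hom (creg (window m) E) (creg (window 0) E) :=
  if m is n.+1 then sing_comp (chain n E) (step n E) else sing_id _.

Lemma chain_equivalence m E : sing_equivalence (chain m E).
Proof.
elim: m => [|m IHm] /=.
  by exists (sing_id _); split; exact: sing_idl.
by apply: sing_equivalence_comp => //; have [] := projT2 (cid (step_ex m)).
Qed.

Lemma chain_natural m (E F : cohs f) (u : kmor E F) :
  sing_eq (sing_comp (chain m F) (creg_map _ u)) (sing_comp (creg_map _ u) (chain m E)).
Proof.
elim: m => [|m IHm] /=.
  exact: sing_trans (sing_idl _) (sing_sym (sing_idr _)).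
by apply: sing_square_comp IHm; have [_ sn _] := projT2 (cid (step_ex m)); exact: sn.
Qed.

(** Every step between the windows n and m takes place outside the support of E, so it is absorbed
    by [kappa]. *)
Lemma chain_kappa m n (E : cohs f) (h : fixes (window m) E) (h' : fixes (window n) E) :
  bounded m E -> (m <= n)%N ->
  sing_eq (sing_comp (chain n E) (ckappa h')) (sing_comp (chain m E) (ckappa h)).
Proof.
move=> bE mn; move: h'; rewrite -(subnK mn); elim: (n - m)%N => [|d IHd] h'.
  (* [kappa] depends on the proof that the walk fixes E, and two such proofs are in play. *)
  by apply: sing_congr_r; apply: sing_map_ext => i x; congr (kappa _ _ _); exact: Prop_irrelevance.
have h'' : fixes (window (d + m)) E by apply: fixes_window bE _; lia.
apply: sing_trans (IHd h''); change (sing_eq (sing_comp (sing_comp (chain (d + m) E)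
  (step (d + m) E)) (ckappa (h' : fixes (window (d + m).+1) E)))
  (sing_comp (chain (d + m) E) (ckappa h''))).
apply: sing_trans (sing_sym (sing_assoc _ _ _)) _; apply: sing_congr_r.
have [_ _ sk] := projT2 (cid (step_ex (d + m))); apply: sk.
by move=> k kdm; apply: bE; lia.
Qed.

End Chain.

(** * The regrading by [window 0] is the fold, up to reindexing even and odd degrees *)

Section Unfold.
Variables (B : comPzRingType) (f : B).

Lemma window0_even j : window 0 (2 * j) = 0.
Proof.
rewrite -[LHS]/(clamp_fun (- 1 - 0%:Z) 0%:Z _) /clamp_fun.
by case: (ltP (2 * j) (- 1 - 0%:Z)) => h1; case: (ltP 0%:Z (2 * j)) => h2; lia.
Qed.

Lemma window0_odd j : window 0 (2 * j - 1) = - 1.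
Proof.
rewrite -[LHS]/(clamp_fun (- 1 - 0%:Z) 0%:Z _) /clamp_fun.
by case: (ltP (2 * j - 1) (- 1 - 0%:Z)) => h1; case: (ltP 0%:Z (2 * j - 1)) => h2; lia.
Qed.

Lemma parity k : (exists j : int, k = 2 * j) \/ (exists j : int, k = 2 * j - 1).
Proof.
have : (k = 2 * (k %/ 2)%Z \/ k = 2 * ((k %/ 2)%Z + 1) - 1) by lia.
by move=> []; [left | right]; eexists; eassumption.
Qed.

Section Reindex.
Variables (F : int -> lmodType B) (e g : int -> int).
Hypothesis eK : cancel e g.

Fact reindex_fin (x : dsum F) : exists s : seq int, forall j, j \notin s -> x (e j) = 0.
Proof.
case: (dval_fin x) => s hs; exists (map g s) => j js; apply: hs.
by apply: contra js => js; rewrite -[j]eK; exact: map_f.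
Qed.

Definition reindex (x : dsum F) : dsum (fun j => F (e j)) := DSum (reindex_fin x).

Lemma reindex_surj (y : dsum (fun j => F (e j))) :
  exists x : dsum F, (forall j, x (e j) = y j) /\ forall k, (forall j, k <> e j) -> x k = 0.
Proof.
have fin : exists s : seq int, forall k, k \notin s ->
    @transport B F (e (g k)) k (y (g k)) = 0.
  case: (dval_fin y) => s hs; exists (map e s) => k ks.
  have [ek|ek] := eqVneq (e (g k)) k; last by rewrite transport_neq.
  rewrite hs ?transport0 //; apply: contra ks => ks; rewrite -ek; exact: map_f.
exists (DSum fin); split=> [j|k hk] /=.
  have h j' : j' = j -> @transport B F (e j') (e j) (y j') = y j by move=> ->; rewrite transport_id.
  exact/h/eK.
by rewrite transport_neq //; apply/eqP => ek; exact: (hk (g k)).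
Qed.
End Reindex.

Fact evenK : cancel (fun j : int => 2 * j) (fun k => (k %/ 2)%Z).
Proof. by move=> j /=; lia. Qed.

Fact oddK : cancel (fun j : int => 2 * j - 1) (fun k => ((k + 1) %/ 2)%Z).
Proof. by move=> j /=; lia. Qed.

Variable E : kdg f.

Definition unfold_fun i : reg E (window 0) i -> fold_kdg E i :=
  match i with
  | Posz 0 => fun x => reindex evenK (incl _ x)
  | Negz 0 => fun x => reindex oddK (incl _ x)
  | _ => fun=> 0
  end.

Fact unfold_linear i : linear (@unfold_fun i).
Proof.
case: i => [[|i]|[|i]] a x y /=; rewrite ?scaler0 ?addr0 //; exact: dsumP.
Qed.

Lemma reg_window0 i (x : reg E (window 0) i) : i != 0 -> i != Negz 0 -> x = 0.
Proof.
move=> i0 i1; apply: partP => k; have [[j ->]|[j ->]] := parity k.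
  by rewrite window0_even eq_sym (negbTE i0).
by rewrite window0_odd eq_sym (negbTE i1).
Qed.

Definition unfold : kmor (reg E (window 0)) (fold_kdg E).
Proof.
exists (fun i => mk_linear (@unfold_linear i)) => i j x.
  have [i0|i0] := eqVneq i 0; first subst i.
    have [j1|j1] := eqVneq j 1; last by rewrite !kd_deg // linear0.
    by subst j; rewrite [RHS]thinmx0 [LHS]thinmx0.
  have [i1|i1] := eqVneq i (Negz 0); last by rewrite (reg_window0 x i0 i1) !linear0.
  subst i; have [j0|j0] := eqVneq j 0; last by rewrite !kd_deg // linear0.
  subst j; apply: dsumP => l.
  have e : incl _ (reg_d E (window 0) (Negz 0) 0 x) (2 * l) = tot E (incl _ x) (2 * l).
    by rewrite reg_dE window0_even.
  apply: etrans e _.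
  rewrite /= /tot_val /odd_to_even_val /=.
  by have -> : 2 * (l + 1) - 1 = 2 * l + 1 by lia.
have [i1|i1] := eqVneq i (Negz 0); first subst i.
  have [j1|j1] := eqVneq j (Negz 1); last by rewrite !kh_deg // linear0.
  by subst j; rewrite [RHS]thinmx0 [LHS]thinmx0.
have [i0|i0] := eqVneq i 0; last by rewrite (reg_window0 x i0 i1) !linear0.
subst i; have [j0|j0] := eqVneq j (Negz 0); last by rewrite !kh_deg // linear0.
subst j; apply: dsumP => l.
have e : incl _ (reg_h E (window 0) 0 (Negz 0) x) (2 * l - 1) = tot E (incl _ x) (2 * l - 1).
  by rewrite reg_hE window0_odd.
apply: etrans e _.
rewrite /= /tot_val /even_to_odd_val /=.
have -> : 2 * (l - 1) = 2 * l - 1 - 1 by lia.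
by have -> : 2 * l - 1 + 1 = 2 * l by lia.
Defined.

Lemma unfold_qis : quasi_iso unfold.
Proof.
have z i : i != 0 -> i != Negz 0 -> forall y : fold_kdg E i, y = 0.
  by case: i => [[|i]|[|i]] // _ _ y; exact: thinmx0.
apply: bij_qis => i.
  have [->|i0] := eqVneq i 0.
    move=> x y e; apply: partP => k; have [[j ->] _|[j ->]] := parity k;
      last by rewrite window0_odd.
    exact: (congr1 (fun w : even_part E => w j) e).
  have [->|i1] := eqVneq i (Negz 0).
    move=> x y e; apply: partP => k; have [[j ->]|[j ->] _] := parity k;
      first by rewrite window0_even.
    exact: (congr1 (fun w : odd_part E => w j) e).
  by move=> x y _; rewrite (reg_window0 x i0 i1) (reg_window0 y i0 i1).
have [->|i0] := eqVneq i 0.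
  move=> y; have [x [xy _]] := reindex_surj evenK y; exists (cut true _ x).
  by apply: dsumP => j; rewrite -xy [LHS]cutE window0_even.
have [->|i1] := eqVneq i (Negz 0).
  move=> y; have [x [xy _]] := reindex_surj oddK y; exists (cut true _ x).
  by apply: dsumP => j; rewrite -xy [LHS]cutE window0_odd.
by move=> y; exists 0; rewrite linear0 [RHS]z.
Qed.

End Unfold.

Lemma unfold_natural (B : comPzRingType) (f : B) (E F : kdg f) (u : kmor E F) i x :
  unfold F i (reg_map u (window 0) i x) = fold_map u i (unfold E i x).
Proof.
have [i0|i0] := eqVneq i 0; first subst i.
  by apply: dsumP => j; rewrite [LHS](congr1 (fun w : dsum F => w (2 * j)) (incl_part_map u x)).
have [i1|i1] := eqVneq i (Negz 0); first subst i.
  by apply: dsumP => j; rewrite [LHS](congr1 (fun w : dsum F => w (2 * j - 1)) (incl_part_map u x)).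
by rewrite (reg_window0 x i0 i1) !linear0.
Qed.

Theorem theorem2p3p3p3 (A B : comPzRingType) (phi : {rmorphism A -> B}) (f : B)
  (A_regular : regular_local A) (B_flat : flat phi) (B_ft : finite_type phi) :
  exists theta : forall E : cohs f, sing_hom E (fold E),
    (forall E : cohs f, sing_equivalence (theta E)) /\
    (forall (E E' : cohs f) (u : kmor E E'),
      sing_eq (sing_comp (theta E') (sing_map u))
              (sing_comp (sing_map (E := fold E) (E' := fold E') (fold_map u))
                         (theta E))).
Proof.
have bnd (E : cohs f) : exists n, bounded n E by case: (coh_sperf E).
(* The bounds are chosen for each module separately, without any compatibility with maps. *)
pose N E := projT1 (cid (bnd E)).
have bN E : bounded (N E) E by exact: projT2 (cid (bnd E)).
pose fixN E := fixes_window (bN E) (leqnn _).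
pose un (E : cohs f) : sing_hom (creg (window 0) E) (fold E) :=
  sing_map (E := creg (window 0) E) (E' := fold E) (unfold E).
exists (fun E => sing_comp (un E) (sing_comp (chain (N E) E) (ckappa (fixN E)))).
split=> [E|E E' u].
  apply: sing_equivalence_comp.
    by apply: sing_equivalence_map; apply: perfect_cone_qis; exact: unfold_qis.
  apply: sing_equivalence_comp; first exact: chain_equivalence.
  by apply: sing_equivalence_map; apply: perfect_cone_qis; exact: kappa_qis.
have un_nat : sing_eq (sing_comp (un E') (creg_map (window 0) u))
    (sing_comp (sing_map (E := fold E) (E' := fold E') (fold_map u)) (un E)).
  apply: (sing_map_square (E := creg (window 0) E) (F := fold E)
    (E' := creg (window 0) E') (F' := fold E')) => i x.
  exact: unfold_natural.
apply: sing_square_comp un_nat.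
(* A map u relates modules with different starting windows. Both composites are rewritten from the
   common window n, where naturality holds step by step. *)
pose n := maxn (N E) (N E').
have h : fixes (window n) E by apply: fixes_window (bN E) _; exact: leq_maxl.
have h' : fixes (window n) E' by apply: fixes_window (bN E') _; exact: leq_maxr.
apply: sing_trans (sing_congl _ (sing_sym (chain_kappa (fixN E') h' (bN E') (leq_maxr _ _)))) _.
apply: sing_trans _ (sing_congr_r _ (chain_kappa (fixN E) h (bN E) (leq_maxl _ _))).
apply: sing_square_comp (chain_natural n u).
apply: (sing_map_square (E := E) (F := creg (window n) E) (E' := E')
  (F' := creg (window n) E')) => i x.
by rewrite kappa_nat.
Qed.
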